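(* The derivation of the conclusion tableau is valid; that is: if $\mathbf{T}=(G,\mathcal{G},\mathcal{M},\mathcal{X},\simeq)$ is a decisive matroid tableau, then the conclusion tableau $\mathbf{T}!$ for $\mathbf{T}$ is a valid matroid tableau.
   Context: Matroids are pairs $M=(E,\mathcal{I})$ with $E$ a finite ground set and $\mathcal{I}$ the system of independent sets; $\mathrm{rk}_M$ is the rank function. A matroid $N=(E',\mathcal{I}')$ is an extension of $M=(E,\mathcal{I})$ if $E\subseteq E'$ and $\mathcal{I}=\{X\in\mathcal{I}'\mid X\subseteq E\}$. A digraph is a pair $D=(V,A)$ with $V$ finite and $A\subseteq V\times V$. A path in $D$ is a non-empty, non-repeating sequence of vertices $p_1p_2\ldots p_n$ with $(p_i,p_{i+1})\in A$ for $1\le i<n$. A routing from $X$ to $Y$ in $D$ is a family $R$ of paths in $D$ such that every $x\in X$ is the first vertex of some $p\in R$, every $p\in R$ ends in a vertex of $Y$, and any two distinct paths of $R$ are vertex-disjoint. For $E,T\subseteq V$, $\Gamma(D,T,E)$ is the matroid on $E$ whose independent sets are those $X\subseteq E$ for which there is a routing from $X$ to $T$ in $D$. A matroid $(E,\mathcal{I})$ is a gammoid if it equals $\Gamma(D,T,E)$ for some digraph $D=(V,A)$ with $E\subseteq V$ and some $T\subseteq V$; it is a strict gammoid if such a representation exists with $V=E$. A matroid tableau is a tuple $\mathbf{T}=(G,\mathcal{G},\mathcal{M},\mathcal{X},\simeq)$ where $G$ is a matroid (the goal), $\mathcal{G},\mathcal{M},\mathcal{X}$ are families of matroids, and $\simeq$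 is an equivalence relation on $\{G'\mid G'\text{ is a minor of }G\}\cup\mathcal{G}\cup\mathcal{M}\cup\mathcal{X}$. $\mathbf{T}$ is valid if (i) all matroids in $\mathcal{G}$ are gammoids, (ii) no matroid in $\mathcal{M}$ is a strict gammoid, (iii) no matroid in $\mathcal{X}$ is a gammoid, and (iv) every equivalence class of $\simeq$ either consists only of gammoids or contains no gammoid. $\mathbf{T}$, with goal $G=(E,\mathcal{I})$, is decisive if it is valid and at least one of the following holds: (D1) there is $M\in\mathcal{G}$ with $G\simeq M$; (D2) there is $X\in\mathcal{X}$ that is isomorphic to a minor of $G$; (D3) for every extension $N=(E',\mathcal{I}')$ of $G$ with $|E'|=\mathrm{rk}_G(E)^2\cdot|E|+\mathrm{rk}_G(E)+|E|$ there is a matroid $M\in\mathcal{M}$ that is isomorphic to $N$. For a decisive tableau $\mathbf{T}$, the tableau $\mathbf{T}!=(G,\mathcal{G}',\mathcal{M},\mathcal{X}',\simeq)$ is the conclusion tableau for $\mathbf{T}$ if either $\mathcal{G}'=\mathcal{G}\cup\{G'\mid G'\text{ is a minor of }G\}$, $\mathcal{X}'=\mathcal{X}$, and $\mathbf{T}$ satisfies (D1); or $\mathcal{G}'=\mathcal{G}$, $\mathcal{X}'=\mathcal{X}\cup\{G\}$, and $\mathbf{T}$ satisfies (D2) or (D3). *)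

(* Defs.v *)
From HB Require Import structures.
From mathcomp Require Import all_boot finmap.
From mathcomp Require Import boolp classical_sets functions cardinality.
Set Implicit Arguments. Unset Strict Implicit. Unset Printing Implicit Defensive.

Local Open Scope fset_scope.

(* All ground sets and vertex sets are finite subsets of one universe K. The   *)
(* main statement assumes K infinite, so that K contains a copy of every finite *)
(* set, and extensions and digraphs never run out of fresh elements.            *)

Definition matroid_axioms (K : choiceType) (E : {fset K})
    (I : {fset {fset K}}) : Prop :=
  [/\ forall X, X \in I -> X `<=` E,
      fset0 \in I,
      forall X Y, X `<=` Y -> Y \in I -> X \in I &
      forall X Y, X \in I -> Y \in I -> #|` X| < #|` Y| ->
        exists2 y, y \in Y `\` X & (y |` X) \in I].

Record matroid (K : choiceType) := Matroid {
  ground : {fset K};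
  indep : {fset {fset K}};
  matroidP : matroid_axioms ground indep }.

Definition rk (K : choiceType) (M : matroid K) (X : {fset K}) : nat :=
  \max_(Y <- indep M | Y `<=` X) #|` Y|.

Section Minors.
Variables (K : choiceType) (M : matroid K).
Implicit Types A B C X Y : {fset K}.

Lemma rk_ge A Y : Y \in indep M -> Y `<=` A -> #|` Y| <= rk M A.
Proof. by move=> YI YA; rewrite /rk (big_rem Y) //= YA leq_maxl. Qed.

Lemma rk_basis A : exists Y, [/\ Y \in indep M, Y `<=` A & #|` Y| = rk M A].
Proof.
have [_ I0 _ _] := matroidP M; rewrite /rk big_seq_cond.
elim/big_ind: _ => [|m n [X [XI XA <-]] [Y [YI YA <-]]|Y /andP[YI YA]].
- by exists fset0; rewrite fsub0set cardfs0.
- by case: (leqP #|` X| #|` Y|) => _; [exists Y | exists X].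
- by exists Y.
Qed.

Lemma rk_mono A B : A `<=` B -> rk M A <= rk M B.
Proof.
move=> AB; have [Y [YI YA <-]] := rk_basis A.
exact: rk_ge YI (fsubset_trans YA AB).
Qed.

Lemma rk_addl A B : rk M (A `|` B) <= (#|` A| + rk M B)%N.
Proof.
have [_ _ Ih _] := matroidP M; have [Y [YI YAB <-]] := rk_basis (A `|` B).
have YB : Y `\` A `<=` B.
  apply/fsubsetP => x; rewrite !inE => /andP[xA /(fsubsetP YAB)].
  by rewrite !inE (negPf xA).
rewrite -(cardfsID A Y) leq_add ?fsubset_leq_card ?fsubsetIr //.
by apply: rk_ge => //; apply: Ih YI; apply: fsubsetDl.
Qed.

Definition restrict_indep X : {fset {fset K}} :=
  [fset Y in indep M | Y `<=` X].

Lemma restrict_axioms X : matroid_axioms (ground M `&` X) (restrict_indep X).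
Proof.
have [IE I0 Ih Ia] := matroidP M; split.
- by move=> Y; rewrite !inE /= fsubsetI => /andP[/IE -> ->].
- by rewrite !inE /= I0 fsub0set.
- move=> Y Z YZ; rewrite !inE /= => /andP[/(Ih _ _ YZ) -> ZX].
  exact: fsubset_trans YZ ZX.
- move=> Y Z; rewrite !inE /= => /andP[YI YX] /andP[ZI ZX] YZ.
  have [z zZY zYI] := Ia _ _ YI ZI YZ; exists z => //.
  rewrite !inE /= zYI fsubUset fsub1set YX andbT /=.
  by apply: (fsubsetP ZX); move: zZY; rewrite inE => /andP[].
Qed.

Definition mrestrict X : matroid K := Matroid (restrict_axioms X).

(* X is independent in M / C when rk_(M / C) X = |X|, where                     *)
(* rk_(M / C) X = rk_M (X `|` C) - rk_M C.                                      *)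
Definition contract_indep C : {fset {fset K}} :=
  [fset X in fpowerset (ground M `\` C) |
    rk M (X `|` C) == (#|` X| + rk M C)%N].

Lemma contract_axioms C : matroid_axioms (ground M `\` C) (contract_indep C).
Proof.
have [IE I0 Ih Ia] := matroidP M; split.
- by move=> X; rewrite !inE /= fpowersetE => /andP[].
- by rewrite !inE /= fpowersetE fsub0set fset0U add0n eqxx.
- move=> X Y XY; rewrite !inE /= !fpowersetE => /andP[YE /eqP rY].
  rewrite (fsubset_trans XY YE) eqn_leq rk_addl /=.
  have cY : (#|` Y `\` X| + #|` X|)%N = #|` Y|.
    by rewrite cardfsDS // subnK // fsubset_leq_card.
  rewrite -(leq_add2l #|` Y `\` X|) addnA cY -rY.
  apply: leq_trans (rk_addl _ _); apply: rk_mono.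
  by apply/fsubsetP => x; rewrite !inE => /orP[] ->; case: (x \in X);
     rewrite ?orbT.
- move=> X Y; rewrite !inE /= !fpowersetE => /andP[XE /eqP rX] /andP[YE /eqP rY].
  move=> XY; have [I [II IXC cI]] := rk_basis (X `|` C).
  have [J [JI JYC cJ]] := rk_basis (Y `|` C).
  have [|y] := Ia _ _ II JI; first by rewrite cI cJ rX rY ltn_add2r.
  rewrite inE => /andP[yI yJ] yII.
  have yXC : y \notin X `|` C.
    apply/negP => yXC; have : #|` y |` I| <= rk M (X `|` C).
      by apply: rk_ge => //; rewrite fsubUset fsub1set yXC.
    by rewrite cardfsU1 yI cI add1n ltnn.
  move: (yXC); rewrite inE negb_or => /andP[yX yC].
  have yY : y \in Y by move/(fsubsetP JYC): yJ; rewrite inE (negPf yC) orbF.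
  exists y; first by rewrite inE yX.
  rewrite !inE /= fpowersetE fsubUset fsub1set XE (fsubsetP YE) //=.
  rewrite eqn_leq rk_addl cardfsU1 yX -addnA -rX -cI /=.
  have -> : (true + #|` I|)%N = #|` y |` I| by rewrite cardfsU1 yI.
  by apply: rk_ge => //; rewrite -fsetUA fsetUS.
Qed.

Definition mcontract C : matroid K := Matroid (contract_axioms C).

End Minors.

Definition minor_of (K : choiceType) (N M : matroid K) : Prop :=
  exists C X, [/\ C `<=` ground M, X `<=` ground M `\` C &
                  N = mrestrict (mcontract M C) X].

Definition extension_of (K : choiceType) (N M : matroid K) : Prop :=
  ground M `<=` ground N /\
  indep M = [fset X in indep N | X `<=` ground M].

Definition isomorphic (K : choiceType) (M N : matroid K) : Prop :=
  exists f : K -> K,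
    [/\ {in ground M &, injective f},
        f @` ground M = ground N &
        forall X : {fset K}, X `<=` ground M ->
          (X \in indep M) = (f @` X \in indep N)].

Record digraph (K : choiceType) := Digraph {
  vertices : {fset K};
  arcs : {fset K * K};
  arcs_sub : arcs `<=` vertices `*` vertices }.

Definition dipath (K : choiceType) (D : digraph K) (p : seq K) : bool :=
  [&& p != [::], uniq p, all [in vertices D] p &
      sorted (fun u v => (u, v) \in arcs D) p].

(* Members of R that start outside X are allowed. *)
Definition routing (K : choiceType) (D : digraph K) (X Y : {fset K})
    (R : {fset seq K}) : Prop :=
  [/\ forall p, p \in R -> dipath D p,
      forall x, x \in X -> exists s, x :: s \in R,
      forall s y, rcons s y \in R -> y \in Y &
      forall p q, p \in R -> q \in R -> p <> q ->
        forall v, ~ (v \in p /\ v \in q)].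

(* M = Gamma(D, T, ground M) *)
Definition represents (K : choiceType) (D : digraph K) (T : {fset K})
    (M : matroid K) : Prop :=
  [/\ ground M `<=` vertices D, T `<=` vertices D &
      forall X : {fset K},
        X \in indep M <-> X `<=` ground M /\ exists R, routing D X T R].

Definition gammoid (K : choiceType) (M : matroid K) : Prop :=
  exists D T, represents D T M.

Definition strict_gammoid (K : choiceType) (M : matroid K) : Prop :=
  exists D T, represents D T M /\ vertices D = ground M.

Local Open Scope classical_set_scope.

Record tableau (K : choiceType) := Tableau {
  goal : matroid K;
  gammoids : set (matroid K);
  nonstrict : set (matroid K);
  nongammoids : set (matroid K);
  tableau_equiv : matroid K -> matroid K -> Prop }.

Section Tableaux.
Variable K : choiceType.
Implicit Type T : tableau K.

Definition minors (M : matroid K) : set (matroid K) :=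
  [set N | minor_of N M].

Definition tableau_dom T : set (matroid K) :=
  minors (goal T) `|` gammoids T `|` nonstrict T `|` nongammoids T.

Definition equivalence_on (S : set (matroid K))
    (R : matroid K -> matroid K -> Prop) : Prop :=
  [/\ forall M N, R M N -> S M /\ S N,
      forall M, S M -> R M M,
      forall M N, R M N -> R N M &
      forall M N P, R M N -> R N P -> R M P].

Definition matroid_tableau T : Prop :=
  equivalence_on (tableau_dom T) (tableau_equiv T).

Definition valid T : Prop :=
  [/\ forall M, gammoids T M -> gammoid M,
      forall M, nonstrict T M -> ~ strict_gammoid M,
      forall M, nongammoids T M -> ~ gammoid M &
      forall M, tableau_dom T M ->
        (forall N, tableau_equiv T M N -> gammoid N) \/
        (forall N, tableau_equiv T M N -> ~ gammoid N)].

Definition D1 T : Prop := exists2 M, gammoids T M & tableau_equiv T (goal T) M.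

Definition D2 T : Prop :=
  exists2 X, nongammoids T X &
    exists2 N, minor_of N (goal T) & isomorphic X N.

Definition D3 T : Prop :=
  let E := ground (goal T) in
  let r := rk (goal T) E in
  forall N, extension_of N (goal T) ->
    (#|` ground N| = r ^ 2 * #|` E| + r + #|` E|)%N ->
    exists2 M, nonstrict T M & isomorphic M N.

Definition decisive T : Prop := valid T /\ [\/ D1 T, D2 T | D3 T].

Definition conclusion_tableau T T' : Prop :=
  [/\ goal T' = goal T, nonstrict T' = nonstrict T, tableau_equiv T' = tableau_equiv T &
      [/\ gammoids T' = gammoids T `|` minors (goal T),
          nongammoids T' = nongammoids T & D1 T] \/
      [/\ gammoids T' = gammoids T,
          nongammoids T' = nongammoids T `|` [set goal T] & D2 T \/ D3 T]].

End Tableaux.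

(* Main.v *)
Require Import Defs.
From mathcomp Require Import all_boot all_algebra finmap.
From mathcomp Require Import mpoly.
From mathcomp Require Import boolp classical_sets functions cardinality.
Set Implicit Arguments. Unset Strict Implicit. Unset Printing Implicit Defensive.
Import GRing.Theory.
Local Open Scope fset_scope.

(** If the goal G is equivalent to a gammoid then it is a gammoid, and so are
    its minors; if a minor of G is isomorphic to a non-gammoid then G is no
    gammoid.  For (D3) one needs that a gammoid G on E of rank r has a strict
    gammoid extension with exactly r^2 |E| + r + |E| elements.

    Write J = V \ T and let B j consist of j and its out-neighbours.  Following
    the paths of a routing (and standing still elsewhere) shows that X is linked
    to T iff the family (B j) has a system of distinct representatives that
    avoids X.  By Hall's theorem this means |X| <= |rim U| for all U containing
    X, where rim U is the set of u in U with u in T or B u not inside U.  As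
    |rim U| is submodular, these X form a matroid.

    For the bound (Kratsch and Wahlstrom's cut-covering argument), first shrink
    V so that |T| = r.  A vertex v of J \ E can be bypassed unless it is
    essential: some A inside E has v in the rim of all U of minimal rim that
    contain A.  Take such a U maximal, and a generic matrix b supported on the
    pairs (j, w) with w in B j.  There are a right kernel vector y of b that
    vanishes on U but not at some w in B v, and a vector z supported on the rows
    j with B j inside U, with z b supported on A, that does not vanish at some p
    with v in B p.  Give the vertices u distinct scalars zeta_u, and let alpha
    be the polynomial with roots zeta_u for u in rim U, u <> v.  The matrix with
    entries alpha_v(zeta_u) y_v(w_u) z_v(p_u), for u and v essential, is diagonal
    with nonzero diagonal, and its rank is at most r * r * |E|. *)

(** * Linear algebra over finite sets *)

Section LinearAlgebra.
Local Open Scope ring_scope.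
Variable K : choiceType.

(** The coefficient matrix with rows indexed by Q has rank at most |I| < |Q|, so its left kernel
    contains a nonzero row; that row, extended by 0 outside Q, is [y]. *)
Lemma underdetermined (F : fieldType) (I : finType) (Q : {fset K})
    (a : I -> K -> F) : (#|I| < #|` Q|)%N ->
  exists y : K -> F,
    [/\ exists2 q, q \in Q & y q != 0, forall q, q \notin Q -> y q = 0 &
        forall i, \sum_(q <- Q) a i q * y q = 0].
Proof.
move=> IQ; pose A := \matrix_(k < #|{: Q}|, i < #|I|)
  a (enum_val i) (fsval (enum_val k)).
have kA : kermx A != 0.
  rewrite -mxrank_eq0 mxrank_ker -lt0n subn_gt0.
  by rewrite (leq_ltn_trans (rank_leq_col A)) // -cardfE.
have [k0 rk0] : exists k, row k (kermx A) != 0.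
  apply/existsP; apply: contraNT kA; rewrite negb_exists => /forallP kA0.
  by apply/eqP/row_matrixP => k; rewrite row0; apply/eqP/negPn/kA0.
pose v := row k0 (kermx A).
have vA : v *m A = 0 by apply/sub_kermxP/row_sub.
pose y q := if insub q is Some q' then v 0 (enum_rank (q' : Q)) else 0.
exists y; split.
- have [k vk] : exists k, v 0 k != 0.
    apply/existsP; apply: contraNT rk0; rewrite negb_exists => /forallP v0.
    by apply/eqP/rowP => k; rewrite [RHS]mxE; apply/eqP/negPn/v0.
  exists (fsval (enum_val k)); first exact: fsvalP.
  by rewrite /y valK enum_valK.
- by move=> q qQ; rewrite /y insubN.
- move=> i; move/rowP/(_ (enum_rank i)): vA; rewrite !mxE => vA.
  rewrite big_seq_fsetE /= -[RHS]vA (reindex _ (onW_bij _ (@enum_val_bij Q))) /=.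
  apply: eq_bigr => k _; rewrite !mxE enum_rankK mulrC; congr (_ * _).
  by rewrite /y valK enum_valK !mxE.
Qed.

(* The entries of b are independent indeterminates, so a square submatrix with a
   perfect matching s has a nonzero determinant: evaluating the indeterminates
   at 1 on the matching and 0 elsewhere gives the identity matrix. *)
Lemma generic_coefficients (V : {fset K}) (B : K -> {fset K}) :
  exists (F : fieldType) (b : K -> K -> F),
  [/\ forall n, n.+1%:R != 0 :> F, forall j w, w \notin B j -> b j w = 0 &
   forall (J : {fset K}) s, {in J &, injective s} -> J `<=` V ->
     (forall j, j \in J -> s j \in B j `&` V) ->
     exists h : K -> K -> F,
       (forall i j, i \in J -> j \in J ->
          \sum_(l <- J) b i (s l) * h l j = (i == j)%:R) /\
       (forall i j, i \in J -> j \in J ->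
          \sum_(l <- J) h i l * b l (s j) = (i == j)%:R)].
Proof.
pose N := #|{: V * V}|.
pose b0 j w : {mpoly rat[N]} :=
  if (insub j, insub w) is (Some j', Some w') then
    if w \in B j then 'X_(enum_rank (j' : V, w' : V)) else 0
  else 0.
exists {fraction {mpoly rat[N]}}, (fun j w => tofrac (b0 j w)); split.
(* Characteristic zero later supplies a distinct scalar for every vertex. *)
- move=> n; rewrite -(rmorph_nat (@tofrac {mpoly rat[N]})) tofrac_eq0.
  rewrite -mpolyC_nat mpolyC_eq0.
  by rewrite Num.Theory.pnatr_eq0.
- move=> j w wB; rewrite /b0 (negPf wB).
  by case: insub => [?|]; [case: insub => [?|]|]; rewrite rmorph0.
move=> J s sI /fsubsetP JV sB.
pose v (n : 'I_N) : rat := let jw := enum_val n in (s (fsval jw.1) == fsval jw.2)%:R.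
have b0v j l : j \in J -> l \in J -> (b0 j (s l)).@[v] = (j == l)%:R.
  move=> jJ lJ; move: (sB _ jJ) (sB _ lJ); rewrite !inE => /andP[sjB _] /andP[_ slV].
  rewrite /b0 (insubT (fun x => x \in V) (JV _ jJ)) (insubT (fun x => x \in V) slV).
  case: ifP => slB; first by rewrite mevalXU /v enum_rankK /= (inj_in_eq sI).
  (* Here [s l] is outside [B j], whereas [s j] is inside, so j and l differ. *)
  by rewrite meval0; case: eqP => // jl; rewrite -jl sjB in slB.
pose M0 := \matrix_(k < #|{: J}|, l < #|{: J}|)
  b0 (fsval (enum_val k)) (s (fsval (enum_val l))).
have evI : injective (fun k : 'I_#|{: J}| => fsval (enum_val k)).
  by move=> k l /val_inj /enum_val_inj.
have dM0 : \det M0 != 0.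
  have : (\det M0).@[v] != 0.
    rewrite -det_map_mx; have -> : map_mx (meval v) M0 = 1%:M.
      by apply/matrixP => k l; rewrite !mxE b0v ?fsvalP // (inj_eq evI).
    by rewrite det1 oner_neq0.
  by apply: contraNneq => ->; rewrite meval0.
pose M := map_mx (@tofrac _) M0.
have uM : M \in unitmx by rewrite unitmxE det_map_mx unitfE tofrac_eq0.
pose h i j := if (insub i, insub j) is (Some i', Some j') then
  invmx M (enum_rank (i' : J)) (enum_rank (j' : J)) else 0.
have hE k l : h (fsval (enum_val k)) (fsval (enum_val l)) = invmx M k l.
  by rewrite /h !valK !enum_valK.
have evE i : i \in J -> exists k : 'I_#|{: J}|, i = fsval (enum_val k).
  by move=> iJ; exists (enum_rank [` iJ]); rewrite enum_rankK.
exists h; split=> _ _ /evE[k ->] /evE[l ->];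
  rewrite (inj_eq evI) big_seq_fsetE (reindex _ (onW_bij _ (@enum_val_bij J))) /=.
- have /matrixP/(_ k l) := mulmxV uM; rewrite !mxE => <-.
  by apply: eq_bigr => m _; rewrite hE !mxE.
- have /matrixP/(_ k l) := mulVmx uM; rewrite !mxE => <-.
  by apply: eq_bigr => m _; rewrite hE !mxE.
Qed.

End LinearAlgebra.

(** * Hall's theorem *)

(** Induction on |J|: match some j0 with some v in [N j0]. If Hall's condition fails for the rest, a
    violating set J1 is tight in the original family, and J1 and its complement can be matched
    separately. The default [dflt] only serves the empty J. *)
Lemma hall (K L : choiceType) (dflt : K -> L) (J : {fset K})
    (N : K -> {fset L}) :
  (forall J' : {fset K}, J' `<=` J -> #|` J'| <= #|` \bigcup_(j <- J') N j|) ->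
  exists s : K -> L, {in J &, injective s} /\ forall j, j \in J -> s j \in N j.
Proof.
have [n] := ubnP #|` J|; elim: n J N => // n IHn J N Jn HJ.
have [->|[j0 j0J]] := fset_0Vmem J; first by exists dflt.
have [v vN] : exists v, v \in N j0.
  have := HJ [fset j0]; rewrite fsub1set cardfs1 big_seq_fset1 => /(_ j0J).
  by rewrite cardfs_gt0 => /fset0Pn.
have cJ0 : (#|` J `\ j0| < n)%N.
  by move: Jn; rewrite (cardfsD1 j0) j0J add1n ltnS.
have [Hv|] := pselect (forall J' : {fset K}, J' `<=` J `\ j0 ->
    #|` J'| <= #|` \bigcup_(j <- J') (N j `\ v)|).
  have [s [sI sN]] := IHn _ _ cJ0 Hv.
  have sv j : j \in J -> j != j0 -> (s j != v) /\ (s j \in N j).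
    move=> jJ jj0; have := sN j; rewrite !inE jj0 jJ => /(_ isT).
    by case/andP.
  exists (fun j => if j == j0 then v else s j); split=> [i j iJ jJ|j jJ].
    have [->|ij0] := eqVneq i j0; have [->|jj0] := eqVneq j j0 => //.
    - by move=> vE; have [] := sv _ jJ jj0; rewrite -vE eqxx.
    - by move=> vE; have [] := sv _ iJ ij0; rewrite vE eqxx.
    - by apply: sI; rewrite !inE ?ij0 ?jj0.
  by have [->//|jj0] := eqVneq j j0; have [] := sv _ jJ jj0.
move=> /existsNP[J1 /not_implyP[J1J /negP]]; rewrite -ltnNge => J1v.
have J1J' : J1 `<=` J by apply: fsubset_trans J1J (fsubD1set _ _).
pose N1 := \bigcup_(j <- J1) N j.
(* Deleting v takes at most one element from N1 and leaves fewer than |J1|. *)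
have cJ1 : #|` J1| = #|` N1|.
  apply/eqP; rewrite eqn_leq HJ //= (cardfsD1 v).
  apply: leq_trans J1v; rewrite -add1n leq_add ?leq_b1 //.
  apply/fsubset_leq_card/fsubsetP => w; rewrite !inE => /andP[wv /bigfcupP[j]].
  by rewrite andbT => jJ1 wN; apply/bigfcupP; exists j; rewrite ?jJ1 // !inE wv.
have [s1 [s1I s1N]] : exists s : K -> L, {in J1 &, injective s} /\
    forall j, j \in J1 -> s j \in N j.
  apply: IHn; first exact: leq_ltn_trans (fsubset_leq_card J1J) cJ0.
  by move=> J' J'J; apply: HJ; apply: fsubset_trans J1J'.
have [s2 [s2I s2N]] : exists s : K -> L, {in J `\` J1 &, injective s} /\
    forall j, j \in J `\` J1 -> s j \in N j `\` N1.
  apply: IHn.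
    rewrite -(ltn_add2l #|` J1|) cardfsD (fsetIidPr J1J') subnKC ?fsubset_leq_card //.
    apply: (leq_trans Jn); rewrite -add1n leq_add2r.
    by apply: leq_ltn_trans J1v.
  move=> J' J'J.
  have J'J1 : [disjoint J' & J1]%fset.
    apply/fdisjointP => x /(fsubsetP J'J); rewrite !inE => /andP[]//.
  (* Subtracting |J1| = |N1| from Hall's condition for the union of J' and J1 leaves the condition
     for J' in the complement of N1. *)
  have /HJ : J' `|` J1 `<=` J.
    by rewrite fsubUset J1J' andbT (fsubset_trans J'J) // fsubsetDl.
  rewrite cardfsU (eqP J'J1) cardfs0 subn0 cJ1.
  have -> : \bigcup_(j <- J' `|` J1) N j =
      \bigcup_(j <- J') (N j `\` N1) `|` N1.
    apply/fsetP => w; rewrite inE; apply/bigfcupP/orP.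
      case=> j; rewrite andbT inE => jJ wj.
      have [wN1|wN1] := boolP (w \in N1); [by right|left].
      case/orP: jJ => jJ.
        by apply/bigfcupP; exists j; rewrite ?jJ // inE wN1.
      by case/negP: wN1; apply/bigfcupP; exists j; rewrite ?jJ.
    case=> /bigfcupP[j]; rewrite andbT => jJ wj; exists j; rewrite ?inE ?jJ ?orbT //.
    by move: wj; rewrite inE => /andP[].
  by rewrite cardfsU => /leq_trans/(_ (leq_subr _ _)); rewrite leq_add2r.
exists (fun j => if j \in J1 then s1 j else s2 j); split=> [i j iJ jJ|j jJ].
  have sN1 k : k \in J1 -> s1 k \in N1.
    by move=> kJ1; apply/bigfcupP; exists k; rewrite ?kJ1 ?s1N.
  have sN2 k : k \in J -> k \notin J1 -> s2 k \notin N1.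
    by move=> kJ kJ1; have := s2N k; rewrite !inE kJ kJ1 => /(_ isT)/andP[].
  case: (boolP (i \in J1)) => iJ1; case: (boolP (j \in J1)) => jJ1.
  - exact: s1I.
  - by move=> sE; have := sN2 _ jJ jJ1; rewrite -sE sN1.
  - by move=> sE; have := sN2 _ iJ iJ1; rewrite sE sN1.
  - by apply: s2I; rewrite inE ?iJ1 ?jJ1.
case: (boolP (j \in J1)) => jJ1; first exact: s1N.
by have := s2N j; rewrite !inE jJ jJ1 => /(_ isT)/andP[].
Qed.

(** Add the same d dummy values [inr i] to every [N j] and apply Hall's theorem; by injectivity at
    most d indices receive a dummy. *)
Lemma hall_deficiency (K : choiceType) d (J : {fset K}) (N : K -> {fset K}) :
  (forall J' : {fset K}, J' `<=` J ->
     #|` J'| <= #|` \bigcup_(j <- J') N j| + d) ->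
  exists (J1 : {fset K}) (s : K -> K),
    [/\ J1 `<=` J, #|` J `\` J1| <= d, {in J1 &, injective s} &
        forall j, j \in J1 -> s j \in N j].
Proof.
move=> HJ; pose D : {fset 'I_d} := [fset i | i in 'I_d].
pose N' j : {fset (K + 'I_d)%type} := (inl @` N j) `|` (inr @` D).
have inlI : injective (@inl K 'I_d) by move=> ? ? [].
have inrI : injective (@inr K 'I_d) by move=> ? ? [].
have cl (A : {fset K}) : #|` [fset (inl x : K + 'I_d) | x in A]| = #|` A|.
  by rewrite card_imfset.
have cr (A : {fset 'I_d}) : #|` [fset (inr x : K + 'I_d) | x in A]| = #|` A|.
  by rewrite card_imfset.
have cD : #|` D| = d by rewrite card_imfset //= -cardE card_ord.
have NE w j : (inl w \in N' j) = (w \in N j).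
  rewrite inE mem_imfset //= orbC; case: imfsetP => //= -[? _ //].
have [J' J'J|s [sI sN]] := @hall K (K + 'I_d)%type inl J N'.
  (* The dummies enter the union only through some index j0, so the empty J' is treated apart. *)
  have [->|[j0 j0J]] := fset_0Vmem J'; first by rewrite cardfs0.
  apply: leq_trans (HJ _ J'J) _; rewrite -cl -[X in (_ + X)%N]cD -cr.
  set P := imfset _ _ _; set Q := imfset _ _ _.
  have dPQ : [disjoint P & Q]%fset.
    by apply/fdisjointP => _ /imfsetP[x _ ->]; apply/imfsetP => -[].
  have <- : #|` P `|` Q| = (#|` P| + #|` Q|)%N.
    by rewrite cardfsU (eqP dPQ) cardfs0 subn0.
  apply/fsubset_leq_card/fsubsetP => w; rewrite inE => /orP[/imfsetP[x xN ->]|wQ].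
    have /bigfcupP[j] : x \in \bigcup_(j <- J') N j := xN.
    rewrite andbT => jJ xNj.
    by apply/bigfcupP; exists j; rewrite ?jJ // NE.
  by apply/bigfcupP; exists j0; rewrite ?j0J // inE wQ orbT.
pose s' j := if s j is inl w then w else j.
pose isl j := if s j is inl _ then true else false.
exists [fset j in J | isl j], s'; split.
- by apply/fsubsetP => j; rewrite !inE => /andP[].
- rewrite -[leqRHS]cD -cr.
  set A := J `\` _; have <- : #|` s @` A| = #|` A|.
    rewrite card_in_imfset //= => i j.
    by rewrite !inE /= => /andP[_ iJ] /andP[_ jJ]; apply: sI.
  apply/fsubset_leq_card/fsubsetP => _ /imfsetP[j /= + ->]; rewrite !inE /=.
  move=> /andP[+ jJ]; rewrite jJ /isl; have := sN j jJ; case: (s j) => //= i _ _.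
  by rewrite mem_imfset // mem_imfset.
- move=> i j; rewrite !inE /= /isl /s' => /andP[iJ] + /andP[jJ].
  case si: (s i) => [x|] // _; case sj: (s j) => [y|] // _ xy.
  by apply: sI => //; rewrite si sj xy.
- move=> j; rewrite !inE /= /isl /s' => /andP[jJ]; have := sN j jJ.
  by case: (s j) => //= w; rewrite NE.
Qed.

(** * Presentations and their matroids *)

(* The digraph with vertices V, targets V `\` J and out-neighbours B j of j. *)
Definition presentation (K : choiceType) (V J : {fset K})
    (B : K -> {fset K}) : Prop :=
  [/\ J `<=` V, forall j, j \in J -> j \in B j &
      forall j, j \in J -> B j `<=` V].

Definition avoidable (K : choiceType) (J : {fset K}) (B : K -> {fset K})
    (X : {fset K}) : Prop :=
  exists s : K -> K,
    {in J &, injective s} /\ forall j, j \in J -> s j \in B j `\` X.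

Definition inner (K : choiceType) (J : {fset K}) (B : K -> {fset K})
    (U : {fset K}) : {fset K} :=
  [fset u in U | (u \in J) && (B u `<=` U)].

(** A separator: these are the vertices of U that are targets or have an arc leaving U, so every
    path from U to a target meets them. *)
Definition rim (K : choiceType) (J : {fset K}) (B : K -> {fset K})
    (U : {fset K}) : {fset K} :=
  U `\` inner J B U.

Section Presentations.
Variables (K : choiceType) (V J : {fset K}) (B : K -> {fset K}).
Hypothesis VJB : presentation V J B.
Implicit Types U W X Y : {fset K}.

Lemma innerE U u : (u \in inner J B U) = [&& u \in U, u \in J & B u `<=` U].
Proof. by rewrite !inE. Qed.

Lemma rimE U u : (u \in rim J B U) = (u \in U) && ~~ ((u \in J) && (B u `<=` U)).
Proof. by rewrite inE innerE; case: (u \in U); rewrite ?andbF ?andbT. Qed.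

Lemma inner_sub U : inner J B U `<=` U.
Proof. by apply/fsubsetP => u; rewrite innerE => /andP[]. Qed.

Lemma card_rim_inner U : (#|` rim J B U| + #|` inner J B U| = #|` U|)%N.
Proof.
rewrite /rim cardfsD (fsetIidPr (inner_sub U)) subnK //.
exact: fsubset_leq_card (inner_sub U).
Qed.

(** |rim U| is |U| minus |inner U|; the first is modular, and [inner] is supermodular, since it maps
    intersections and unions to sets containing the intersection and union of the images. *)
Lemma rim_submod U W :
  #|` rim J B (U `&` W)| + #|` rim J B (U `|` W)| <=
  #|` rim J B U| + #|` rim J B W|.
Proof.
have inI : inner J B U `&` inner J B W `<=` inner J B (U `&` W).
  apply/fsubsetP => u; rewrite inE !innerE inE fsubsetI.
  by case/andP => /and3P[-> -> ->] /and3P[-> _ ->].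
have inU : inner J B U `|` inner J B W `<=` inner J B (U `|` W).
  apply/fsubsetP => u; rewrite inE !innerE inE.
  case/orP => /and3P[-> -> BU]; rewrite ?orbT /= (fsubset_trans BU) //.
    exact: fsubsetUl.
  exact: fsubsetUr.
have := leq_add (fsubset_leq_card inI) (fsubset_leq_card inU).
rewrite [X in (X <= _)%N]addnC cardfsUI.
rewrite -(leq_add2l (#|` rim J B (U `&` W)| + #|` rim J B (U `|` W)|)).
rewrite addnACA [X in (_ <= X)%N]addnACA !card_rim_inner.
rewrite [X in (_ <= X)%N]addnC cardfsUI -(card_rim_inner U) -(card_rim_inner W).
by rewrite [X in (_ <= X)%N]addnACA addnACA leq_add2r.
Qed.

(** This is Hall's condition for the sets B j minus X. A transversal injects [inner J B U] into U
    minus X. Conversely, for a subfamily J' with union N take U to be the union of X and N: as j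
    lies in B j, all of J' is inner to U. *)
Lemma avoidableP X : X `<=` V -> avoidable J B X <->
  forall U, X `<=` U -> U `<=` V -> #|` X| <= #|` rim J B U|.
Proof.
have [JV JB BV] := VJB => XV; split=> [[s [sI sB]] U XU UV|H].
  rewrite -(leq_add2r #|` inner J B U|) card_rim_inner -(subnKC (fsubset_leq_card XU)).
  rewrite leq_add2l -[X in _ - X](congr1 (fun A : {fset K} => #|` A|) (fsetIidPr XU)).
  rewrite -cardfsD; have <- : #|` s @` inner J B U| = #|` inner J B U|.
    rewrite card_in_imfset //= => i j.
    by rewrite !innerE => /and3P[_ iJ _] /and3P[_ jJ _]; apply: sI.
  apply/fsubset_leq_card/fsubsetP => _ /imfsetP[j /= + ->].
  rewrite innerE => /and3P[_ jJ /fsubsetP BU].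
  by have := sB _ jJ; rewrite !inE => /andP[-> /BU].
have [|s [sI sB]] := @hall K K id J (fun j => B j `\` X); last by exists s.
move=> J' J'J; set N := \bigcup_(j <- J') _.
have NP w j : j \in J' -> w \in B j -> w \notin X -> w \in N.
  by move=> jJ wB wX; apply/bigfcupP; exists j; rewrite ?jJ // inE wX.
have NV w : w \in N -> w \in V `\` X.
  case/bigfcupP => j; rewrite andbT !inE => /(fsubsetP J'J)/BV/fsubsetP BjV.
  by case/andP => -> /BjV.
have := H (X `|` N) (fsubsetUl _ _); have -> : X `|` N `<=` V.
  rewrite fsubUset XV; apply/fsubsetP => w /NV.
  by rewrite inE => /andP[].
move/(_ isT); rewrite -(leq_add2r #|` inner J B (X `|` N)|) card_rim_inner.
rewrite cardfsU; have -> : X `&` N = fset0.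
  by apply/fsetP => w; rewrite !inE; apply/negP => /andP[wX /NV]; rewrite !inE wX.
rewrite cardfs0 subn0 leq_add2l; apply: leq_trans.
apply/fsubset_leq_card/fsubsetP => j jJ'; have jJ := fsubsetP J'J _ jJ'.
have BjU : B j `<=` X `|` N.
  apply/fsubsetP => w wB; rewrite inE; have [//|wX] := boolP (w \in X).
  exact: NP jJ' wB wX.
by rewrite innerE jJ BjU (fsubsetP BjU) // JB.
Qed.

(** Uncrossing: for two sets of rim at most k containing X, the intersection still has rim at least
    k, so by submodularity the union has rim at most k. U0 starts the induction. *)
Lemma tight_union k X Y U0 :
  (forall U, X `<=` U -> U `<=` V -> k <= #|` rim J B U|) ->
  [/\ X `<=` U0, U0 `<=` V & #|` rim J B U0| <= k] ->
  (forall y, y \in Y ->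
     exists U, [/\ y |` X `<=` U, U `<=` V & #|` rim J B U| <= k]) ->
  exists U, [/\ X `|` Y `<=` U, U `<=` V & #|` rim J B U| <= k].
Proof.
move=> minX [XU0 U0V U0k] HY.
suff [U [XU UV Uk YU]] : exists U,
    [/\ X `<=` U, U `<=` V, #|` rim J B U| <= k & {subset (enum_fset Y : seq K) <= U}].
  by exists U; split=> //; rewrite fsubUset XU; apply/fsubsetP.
have {}HY : forall y, y \in (enum_fset Y : seq K) -> exists U,
    [/\ y |` X `<=` U, U `<=` V & #|` rim J B U| <= k] := HY.
elim: (enum_fset Y : seq K) HY => [|y s IHs] Hs; first by exists U0; split.
have [|U [XU UV Uk sU]] := IHs; first by move=> x xs; apply: Hs; rewrite inE xs orbT.
have [|W [yXW WV Wk]] := Hs y; first by rewrite inE eqxx.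
move: yXW; rewrite fsubUset fsub1set => /andP[yW XW].
exists (U `|` W); split.
- exact: fsubset_trans XU (fsubsetUl _ _).
- by rewrite fsubUset UV WV.
- rewrite -(leq_add2l k); apply: leq_trans (leq_add Uk Wk).
  apply: leq_trans (rim_submod U W); rewrite leq_add2r minX //.
    by rewrite fsubsetI XU XW.
  exact: fsubset_trans (fsubsetIl _ _) UV.
- move=> x; rewrite !inE => /predU1P[->|/sU ->//].
  by rewrite yW orbT.
Qed.

(** Each y that cannot be added to X yields, by [avoidableP], a set of rim at most |X| around X and
    y, and [tight_union] merges these. X itself starts the union, its rim being a subset of it. *)
Lemma avoidable_span X Y : X `<=` V -> Y `<=` V -> avoidable J B X ->
  (forall y, y \in Y `\` X -> ~ avoidable J B (y |` X)) ->
  exists U, [/\ X `|` Y `<=` U, U `<=` V & #|` rim J B U| <= #|` X|].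
Proof.
move=> XV YV /(avoidableP XV) aX nY.
have [||U [XU UV Uk]] := @tight_union #|` X| X (Y `\` X) X aX.
- by split=> //; exact/fsubset_leq_card/fsubsetDl.
- move=> y yYX; have yX : y \notin X by move: yYX; rewrite inE => /andP[].
  have yXV : y |` X `<=` V.
    by move: yYX; rewrite fsubUset XV fsub1set inE => /andP[_ /(fsubsetP YV) ->].
  apply: contrapT => nU; apply: (nY y yYX); apply/(avoidableP yXV) => U yU UV.
  rewrite leqNgt; apply/negP; rewrite cardfsU1 yX add1n ltnS => Uk.
  by apply: nU; exists U.
- exists U; split=> //; apply: fsubset_trans XU.
  by apply/fsubsetP => x; rewrite !inE; case: (x \in X).
Qed.

Lemma avoidable_sub X Y : X `<=` Y -> avoidable J B Y -> avoidable J B X.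
Proof.
move=> /fsubsetP XY [s [sI sB]]; exists s; split=> // j /sB.
by rewrite !inE => /andP[sY ->]; rewrite andbT; apply: contra sY; apply: XY.
Qed.

Lemma avoidable0 : avoidable J B fset0.
Proof.
have [_ JB _] := VJB.
by exists id; split=> // j jJ; rewrite inE /= JB.
Qed.

(** The dual of the transversal matroid of the family B j, j in J: a set is independent when its
    complement in V contains a full transversal. *)
Definition cotransversal_indep : {fset {fset K}} :=
  [fset X in fpowerset V | `[< avoidable J B X >]].

Lemma cotransversal_indepE X :
  X \in cotransversal_indep <-> X `<=` V /\ avoidable J B X.
Proof. by rewrite !inE /= fpowersetE; split=> [/andP[->] /asboolP|[-> /asboolP]]. Qed.

Lemma cotransversal_axioms : matroid_axioms V cotransversal_indep.
Proof.
split.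
- by move=> X /cotransversal_indepE[].
- by apply/cotransversal_indepE; split; [apply: fsub0set|apply: avoidable0].
- move=> X Y XY /cotransversal_indepE[YV aY]; apply/cotransversal_indepE.
  by split; [apply: fsubset_trans YV|apply: avoidable_sub aY].
move=> X Y /cotransversal_indepE[XV aX] /cotransversal_indepE[YV aY] XY.
(* If no y augments X, some U containing X and Y has rim at most |X| < |Y|, so Y cannot be
   avoidable. *)
apply: contrapT => nY; have [y yYX aXy|U [XYU UV Uk]] := avoidable_span XV YV aX.
  apply: nY; exists y => //; apply/cotransversal_indepE; split=> //.
  by move: yYX; rewrite fsubUset XV fsub1set inE => /andP[_ /(fsubsetP YV) ->].
move/(avoidableP YV)/(_ U): aY; rewrite UV (fsubset_trans (fsubsetUr _ _) XYU).
by move=> /(_ isT isT) /leq_trans/(_ Uk); rewrite leqNgt XY.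
Qed.

Definition cotransversal : matroid K := Matroid cotransversal_axioms.

End Presentations.

(** * Routings *)

Section Routings.
Variables (K : choiceType) (D : digraph K) (T J : {fset K}) (B : K -> {fset K}).
Hypothesis JE : J = vertices D `\` T.
Hypothesis BE : forall v w, v \in J ->
  (w \in B v) = (w == v) || ((v, w) \in arcs D).

(** The transversal moves each vertex of a path to its cyclic successor and fixes all others. It
    permutes every path, hence is injective; only the last vertex of a path wraps around to the
    start, and that one is a target, outside J. *)
Lemma routing_avoidable X R : routing D X T R -> avoidable J B X.
Proof.
case=> Rdi RX RT Rdisj.
have same p q v : p \in R -> q \in R -> v \in p -> v \in q -> p = q.
  move=> pR qR vp vq; apply: contrapT => pq.
  exact: (Rdisj _ _ pR qR pq v).
(* Leaving targets unconstrained in [e] makes every path of R an [e]-cycle, including the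
   wrap-around step. *)
pose e u w := (u \in T) || ((u, w) \in arcs D) && (w \notin X).
have Rcyc p : p \in R -> cycle e p.
  case: p => // x p pR; have /and4P[_ /= /andP[xp up] _ pe] := Rdi _ pR.
  (* A later vertex in X would start a path of R, by disjointness this same path, which would then
     repeat it. *)
  have pX y : y \in p -> y \notin X.
    move=> yp; apply/negP => /RX[q qR].
    have := same _ _ y pR qR; rewrite !inE yp eqxx orbT => /(_ isT isT)[xy _].
    by rewrite xy yp in xp.
  have lT : last x p \in T.
    by move: pR; rewrite lastI => /RT.
  rewrite rcons_path [e (last x p) x]/e lT andbT.
  elim: p x pe pX {xp up lT pR} => //= y p IHp x /andP[xy yp] pX.
  rewrite /e xy pX ?inE ?eqxx ?orbT //= IHp // => z zp.
  by apply: pX; rewrite inE zp orbT.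
pose s v := if pselect (exists2 p, p \in R & v \in p) is left H
  then next (s2val (cid2 H)) v else v.
have sR p v : p \in R -> v \in p -> s v = next p v.
  move=> pR vp; rewrite /s; case: pselect => [H|[]]; last by exists p.
  by case: cid2 => q /= qR vq; rewrite (same _ _ v pR qR).
have sN v : ~ (exists2 p, p \in R & v \in p) -> s v = v.
  by move=> H; rewrite /s; case: pselect.
exists s; split=> [u v uJ vJ|v vJ].
  have [[p pR up]|nu] := pselect (exists2 p, p \in R & u \in p); last first.
    rewrite (sN u) //; have [[q qR vq]|nv] := pselect (exists2 p, p \in R & v \in p).
      by rewrite (sR _ _ qR vq) => uE; case: nu; exists q; rewrite // uE mem_next.
    by rewrite sN.
  rewrite (sR _ _ pR up); have [[q qR vq]|nv] := pselect (exists2 p, p \in R & v \in p).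
    rewrite (sR _ _ qR vq) => uv; have qp : q = p.
      by apply: (same _ _ (next q v)); rewrite // ?mem_next // -uv mem_next.
    rewrite qp in uv; have /and4P[_ uniqp _ _] := Rdi _ pR.
    by rewrite -(prev_next uniqp u) uv prev_next.
  by rewrite (sN v) // => vE; case: nv; exists p; rewrite // -vE mem_next.
rewrite inE BE //; have [[p pR vp]|nv] := pselect (exists2 p, p \in R & v \in p).
  rewrite (sR _ _ pR vp); have := next_cycle (Rcyc _ pR) vp; rewrite /e.
  move: (vJ); rewrite JE inE => /andP[/negPf -> _] /= /andP[-> ->].
  by rewrite orbT.
rewrite sN // eqxx andbT; apply/negP => /RX[q qR].
by apply: nv; exists (v :: q); rewrite // inE eqxx.
Qed.

(** From every x in X iterate [s] until J is left. As [s] is injective on J with values outside X,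
    orbits neither merge nor return, and a vertex outside J is a target. *)
Lemma avoidable_routing X : X `<=` vertices D -> avoidable J B X ->
  exists R, routing D X T R.
Proof.
move=> /fsubsetP XV [s [sI sB]].
have sX j : j \in J -> s j \notin X by move/sB; rewrite inE => /andP[].
have iter_inj i j x y : x \in X -> y \in X ->
    (forall k, k < i -> iter k s x \in J) -> (forall k, k < j -> iter k s y \in J) ->
    iter i s x = iter j s y -> i = j /\ x = y.
  move=> xX yX; elim: i j => [|i IHi] [|j] iJ jJ //=.
  - by move=> xE; have := sX _ (jJ j (ltnSn j)); rewrite -xE xX.
  - by move=> yE; have := sX _ (iJ i (ltnSn i)); rewrite yE yX.
  move/sI => /(_ (iJ _ (ltnSn _)) (jJ _ (ltnSn _))).
  by case/IHi => [k /ltnW/iJ|k /ltnW/jJ|-> ->].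
(* Otherwise the first |J| + 1 iterates would be distinct members of J. *)
have Xfin x : x \in X -> has [pred y | y \notin J] (traject s x #|` J|.+1).
  move=> xX; apply/negPn/negP => /hasPn nJ.
  have xJ i : i < #|` J|.+1 -> iter i s x \in J.
    move=> ij; have /nJ : iter i s x \in traject s x #|` J|.+1.
      by apply/trajectP; exists i.
    by rewrite /= negbK.
  suff : #|` J|.+1 <= #|` J| by rewrite ltnn.
  rewrite -[X in X <= _](size_traject s x); apply: uniq_leq_size; last first.
    by move=> _ /trajectP[i ij ->]; apply: xJ.
  apply/(uniqP x) => i j; rewrite !inE size_traject => iJ jJ.
  rewrite !nth_traject // => /iter_inj[] // k; [move/ltn_trans/(_ iJ)|move/ltn_trans/(_ jJ)];
    exact: xJ.
pose m x := find [pred y | y \notin J] (traject s x #|` J|.+1).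
have mlt x : x \in X -> m x < #|` J|.+1.
  by move/Xfin; rewrite has_find size_traject.
have mJ x : x \in X -> iter (m x) s x \notin J.
  move=> xX; have := nth_find x (Xfin x xX); rewrite nth_traject //.
  exact: mlt.
have ltmJ x k : x \in X -> k < m x -> iter k s x \in J.
  move=> xX km; have := before_find x km; rewrite nth_traject ?(ltn_trans km) ?mlt //.
  by move/negbFE.
have iterV x k : x \in X -> k <= m x -> iter k s x \in vertices D.
  move=> xX; case: k => [|k] km /=; first exact: XV.
  have kJ := ltmJ _ _ xX km; have := sB _ kJ; rewrite inE BE // => /andP[_].
  case/orP => [/eqP ->|]; first by move: kJ; rewrite JE inE => /andP[].
  by move/(fsubsetP (arcs_sub D)); rewrite inE /= => /andP[].
exists [fset traject s x (m x).+1 | x in X]; split.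
- move=> _ /imfsetP[x /= xX ->].
  have [p pE] : exists p, p = traject s x (m x).+1 by eexists.
  have sp : size p = (m x).+1 by rewrite pE size_traject.
  have np i : i < (m x).+1 -> nth x p i = iter i s x.
    by rewrite pE => /(nth_traject s) ->.
  have pi y : y \in p -> exists2 i, i < (m x).+1 & y = iter i s x.
    by rewrite pE => /trajectP.
  rewrite -trajectS -pE; apply/and4P; split; first by rewrite pE.
  + apply/(uniqP x) => i j; rewrite !inE sp !ltnS => im jm.
    rewrite !np // => /iter_inj[] // k kl; apply: ltmJ => //.
      exact: leq_trans kl im.
    exact: leq_trans kl jm.
  + by apply/allP => _ /pi[i im ->]; apply: iterV.
  + apply/(sortedP x) => i; rewrite sp => im.
    rewrite !np //; last exact: ltnW.
    have iJ : iter i s x \in J by apply: ltmJ.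
    have := sB _ iJ; rewrite inE BE // => /andP[_ /orP[/eqP sE|//]].
    (* Standing still is excluded: equal consecutive iterates would force i + 1 = i. *)
    have [||/eqP] // := iter_inj i.+1 i x x xX xX _ _ sE.
    * by move=> k; rewrite ltnS => ki; apply: ltmJ => //; apply: leq_ltn_trans ki im.
    * by move=> k ki; apply: ltmJ => //; apply: ltn_trans ki im.
    * by rewrite eqn_leq ltnn.
- by move=> x xX; exists (traject s (s x) (m x)); apply/imfsetP; exists x.
- move=> p y /imfsetP[x /= xX pE]; have := mJ x xX.
  have -> : iter (m x) s x = y.
    by rewrite -(last_rcons x p y) pE /= last_traject.
  apply: contraNT => yT; rewrite JE inE yT.
  have /trajectP[i im ->] : y \in traject s x (m x).+1.
    by rewrite trajectS -pE mem_rcons inE eqxx.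
  exact: iterV.
- move=> _ _ /imfsetP[x /= xX ->] /imfsetP[y /= yX ->] pq v.
  rewrite -!trajectS => -[/trajectP[i im ->] /trajectP[j jm]].
  move=> /iter_inj[] // => [k ki|k kj|_ xy].
  + exact: ltmJ xX (leq_trans ki im).
  + exact: ltmJ yX (leq_trans kj jm).
  + by apply: pq; rewrite xy.
Qed.

End Routings.

(** * Gammoids in terms of presentations *)

Definition presents (K : choiceType) (V J : {fset K}) (B : K -> {fset K})
    (M : matroid K) : Prop :=
  [/\ presentation V J B, ground M `<=` V &
      forall X : {fset K},
        X \in indep M <-> X `<=` ground M /\ avoidable J B X].

Section GammoidPresentation.
Variables (K : choiceType) (M : matroid K).

Lemma represents_presents (D : digraph K) T : represents D T M ->
  exists J B, presents (vertices D) J B M.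
Proof.
case=> ED TD MI.
pose J := vertices D `\` T; pose B v := v |` [fset w in vertices D | (v, w) \in arcs D].
have BE v w : v \in J -> (w \in B v) = (w == v) || ((v, w) \in arcs D).
  move=> _; rewrite !inE /=; congr (_ || _); apply: andb_idl.
  by move/(fsubsetP (arcs_sub D)); rewrite inE => /andP[].
exists J, B; split=> //.
  split=> [|j _|j jJ]; [exact: fsubsetDl|by rewrite !inE eqxx|].
  apply/fsubsetP => w; rewrite !inE => /predU1P[->|/andP[]//].
  by move: jJ; rewrite inE => /andP[].
move=> X; rewrite MI; split=> -[XE H]; split=> //.
  by case: H => R; apply: routing_avoidable.
exact: (avoidable_routing _ BE (fsubset_trans XE ED) H).
Qed.

Lemma presents_represents V J B : presents V J B M ->
  exists D T, represents D T M /\ vertices D = V.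
Proof.
case=> [[JV JB BV] EV MI].
have arcsP : [fset a in V `*` V | (a.1 \in J) && (a.2 \in B a.1)] `<=` V `*` V.
  by apply/fsubsetP => a; rewrite !inE /= => /andP[].
pose D := Digraph arcsP; exists D, (V `\` J); split=> //; split=> //.
  exact: fsubsetDl.
have JE : J = vertices D `\` (V `\` J).
  apply/fsetP => x; rewrite !inE negb_and negbK.
  by case: (boolP (x \in J)) => [/(fsubsetP JV) ->|_] //=; case: (x \in V).
have BE v w : v \in J -> (w \in B v) = (w == v) || ((v, w) \in arcs D).
  move=> vJ; rewrite !inE /= vJ (fsubsetP JV) //=.
  case: eqVneq => [->|_] /=; first by rewrite JB.
  by case: (boolP (w \in B v)) => [/(fsubsetP (BV _ vJ)) ->|]; rewrite ?andbF.
move=> X; rewrite MI; split=> -[XE H]; split=> //.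
  exact: (avoidable_routing JE BE (fsubset_trans XE EV) H).
by case: H => R; apply: routing_avoidable.
Qed.

Lemma gammoidP : gammoid M <-> exists V J B, presents V J B M.
Proof.
split=> [[D [T /represents_presents[J [B P]]]]|[V [J [B]]]].
  by exists (vertices D), J, B.
by case/presents_represents => D [T [DT _]]; exists D, T.
Qed.

Lemma strict_gammoidP : strict_gammoid M <-> exists J B, presents (ground M) J B M.
Proof.
split=> [[D [T [/represents_presents P <-]]]|[J [B]]]; first by [].
by case/presents_represents => D [T DT]; exists D, T.
Qed.

End GammoidPresentation.

(** * Isomorphic copies and minors *)

Section FiniteInjections.
Variable K : choiceType.

Lemma left_inverse_on (J : {fset K}) (s : K -> K) : {in J &, injective s} ->
  exists t : K -> K, {in J, cancel s t}.
Proof.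
move=> sI.
exists (fun k => if pselect (exists2 j, j \in J & s j = k) is left H
  then s2val (cid2 H) else k).
move=> j jJ; case: pselect => [H|[]]; last by exists j.
by case: cid2 => i /= iJ /sI ->.
Qed.

Hypothesis Kinf : infinite_set [set: K]%classic.

Lemma fresh_fset (V : {fset K}) n :
  exists2 Z : {fset K}, #|` Z| = n & [disjoint Z & V]%fset.
Proof.
elim: n => [|n [Z Zn ZV]].
  by exists fset0; rewrite ?cardfs0 // fdisjoint0X.
have [A _ cA] := infinite_set_fset #|` Z `|` V|.+1 Kinf.
have [x xA] : exists x, x \in A `\` (Z `|` V).
  apply/fset0Pn; rewrite -cardfs_gt0 cardfsD subn_gt0.
  by apply: leq_trans cA; rewrite ltnS fsubset_leq_card // fsubsetIr.
move: xA; rewrite !inE negb_or => /andP[/andP[xZ xV] _].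
exists (x |` Z); first by rewrite cardfsU1 xZ Zn.
apply/fdisjointP => y; rewrite !inE => /predU1P[->//|].
exact: (fdisjointP ZV).
Qed.

(** V minus E is sent, position by position, to fresh elements outside the image of E. This renames
    the vertices of a digraph that lie outside the ground set. *)
Lemma extend_injection (V E : {fset K}) (h : K -> K) :
  {in E &, injective h} ->
  exists g : K -> K, {in V &, injective g} /\ {in E, g =1 h}.
Proof.
move=> hI; have [Z cZ /fdisjointP ZE] := fresh_fset (h @` E) #|` V `\` E|.
pose r v := index v (enum_fset (V `\` E)).
have rZ v : v \in V -> v \notin E -> r v < #|` Z|.
  by move=> vV vE; rewrite cZ index_mem inE vE.
exists (fun v => if v \in E then h v else nth v (enum_fset Z) (r v)).
split=> [u v uV vV|v ->//].
have NE w z : w \in V -> w \notin E -> z \in E ->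
    nth w (enum_fset Z) (r w) <> h z.
  move=> wV wE zE wz; have /ZE : nth w (enum_fset Z) (r w) \in Z.
    by apply: mem_nth; apply: rZ.
  by rewrite wz => /imfsetP[]; exists z.
case: (boolP (u \in E)) => uE; case: (boolP (v \in E)) => vE.
- exact: hI.
- by move/esym/NE => [].
- by move/NE => [].
have vZ := rZ _ vV vE; have uZ := rZ _ uV uE.
rewrite (set_nth_default u) // => /eqP; rewrite nth_uniq ?fset_uniq // => /eqP ruv.
have uVE : u \in V `\` E by rewrite inE uE.
have vVE : v \in V `\` E by rewrite inE vE.
by rewrite -(nth_index u uVE) -/(r u) ruv nth_index.
Qed.

End FiniteInjections.

Section GammoidClosure.
Variable K : choiceType.
Implicit Types (M N : matroid K) (C X Y : {fset K}).

(** While [f] maps M to N, [g] carries all of V back to a copy around the ground set of M;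
    transversals are conjugated by [g] and its left inverse [t]. *)
Lemma presents_iso V J B M N (f g : K -> K) :
  presents V J B N -> {in V &, injective g} ->
  f @` ground M = ground N -> {in ground M, cancel f g} ->
  (forall X, X `<=` ground M -> (X \in indep M) = (f @` X \in indep N)) ->
  exists J' B', presents (g @` V) J' B' M.
Proof.
move=> [[JV JB BV] EV NI] gI fE fg MN; have [t gt] := left_inverse_on gI.
have JVs j : j \in J -> j \in V by apply: (fsubsetP JV).
have BVs j w : j \in J -> w \in B j -> w \in V by move/BV/fsubsetP; apply.
have fN x : x \in ground M -> f x \in V.
  by move=> xM; apply: (fsubsetP EV); rewrite -fE in_imfset.
exists (g @` J), (fun k => g @` B (t k)); split.
- split.
  + by apply/fsubsetP => _ /imfsetP[j /= /JVs jV ->]; rewrite in_imfset.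
  + by move=> _ /imfsetP[j /= jJ ->]; rewrite gt ?JVs // in_imfset //= JB.
  + move=> _ /imfsetP[j /= jJ ->]; rewrite gt ?JVs //.
    by apply/fsubsetP => _ /imfsetP[w /= /(BVs _ _ jJ) wV ->]; rewrite in_imfset.
- by apply/fsubsetP => x xM; rewrite -(fg _ xM) in_imfset //=; apply: fN.
move=> X; have [XM|XM] := boolP (X `<=` ground M); last first.
  have [IM _ _ _] := matroidP M.
  by split=> [/IM|[]//]; rewrite (negPf XM).
have fXN : f @` X `<=` ground N.
  rewrite -fE; apply/fsubsetP => _ /imfsetP[x /= /(fsubsetP XM) xM ->].
  by rewrite in_imfset.
rewrite MN // NI; split=> -[_ [s [sI sB]]]; split=> //.
  have sV j : j \in J -> s j \in V.
    by move=> jJ; have := sB j jJ; rewrite inE => /andP[_ /(BVs _ _ jJ)].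
  exists (g \o s \o t); split=> [_ _ /imfsetP[i /= iJ ->] /imfsetP[j /= jJ ->]|].
    by rewrite !gt ?JVs // => /gI; rewrite !sV // => /(_ isT isT)/sI ->.
  move=> _ /imfsetP[j /= jJ ->]; rewrite gt ?JVs // inE.
  have := sB j jJ; rewrite inE => /andP[sX sBj]; rewrite in_imfset // andbT.
  apply: contra sX => gsX; have gsM := fsubsetP XM _ gsX.
  have -> : s j = f (g (s j)).
    by apply: gI; rewrite ?sV ?fN // fg.
  by rewrite in_imfset.
have sB' j : j \in J -> exists2 w, w \in B j & s (g j) = g w /\ g w \notin X.
  move=> jJ; have := sB (g j); rewrite in_imfset // gt ?JVs // => /(_ isT).
  by rewrite inE => /andP[+ /imfsetP[w /= wB sw]]; rewrite sw; exists w.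
have ts j : j \in J -> [/\ t (s (g j)) \in B j, g (t (s (g j))) = s (g j) &
    s (g j) \notin X].
  by move=> jJ; have [w wB [-> wX]] := sB' j jJ; rewrite gt // (BVs _ _ jJ).
exists (t \o s \o g); split=> [i j iJ jJ /= tij|j jJ /=].
  apply: gI; rewrite ?JVs //; apply: sI; rewrite ?in_imfset //.
  by have [_ <- _] := ts i iJ; have [_ <- _] := ts j jJ; rewrite tij.
have [tB gts sX] := ts j jJ; rewrite inE tB andbT; apply: contra sX.
case/imfsetP => x /= xX tx; rewrite -gts tx fg //.
exact: (fsubsetP XM).
Qed.

Lemma isomorphic_cancel M N : isomorphic M N -> exists f g : K -> K,
  [/\ f @` ground M = ground N, {in ground M, cancel f g},
      {in ground N &, injective g} &
      forall X, X `<=` ground M -> (X \in indep M) = (f @` X \in indep N)].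
Proof.
case=> f [fI fE MN]; have [g fg] := left_inverse_on fI; exists f, g; split=> //.
by rewrite -fE => _ _ /imfsetP[x /= xM ->] /imfsetP[y /= yM ->]; rewrite !fg // => ->.
Qed.

Lemma strict_gammoid_iso M N : isomorphic M N -> strict_gammoid N -> strict_gammoid M.
Proof.
case/isomorphic_cancel => f [g [fE fg gI MN]] /strict_gammoidP[J [B P]].
have [J' [B' P']] := presents_iso P gI fE fg MN.
apply/strict_gammoidP; exists J', B'; move: P'; rewrite -fE.
suff -> : g @` (f @` ground M) = ground M by [].
apply/fsetP => x; apply/imfsetP/idP => /=.
  by case=> _ /imfsetP[y /= yM ->] ->; rewrite fg.
by move=> xM; exists (f x); rewrite ?fg // in_imfset.
Qed.

Lemma gammoid_iso (Kinf : infinite_set [set: K]%classic) M N :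
  isomorphic M N -> gammoid N -> gammoid M.
Proof.
case/isomorphic_cancel => f [g [fE fg gI MN]] /gammoidP[V [J [B P]]].
have [g' [g'I gg']] := extend_injection Kinf V gI.
have fg' : {in ground M, cancel f g'}.
  by move=> x xM; rewrite gg' ?fg // -fE in_imfset.
have [J' [B' P']] := presents_iso P g'I fE fg' MN.
by apply/gammoidP; exists (g' @` V), J', B'.
Qed.

Lemma gammoid_restrict M X : gammoid M -> gammoid (mrestrict M X).
Proof.
move/gammoidP => [V [J [B [VJB EV MI]]]]; apply/gammoidP; exists V, J, B; split=> //.
  by apply: fsubset_trans EV; apply: fsubsetIl.
move=> Y; rewrite !inE /= fsubsetI; split.
  by case/andP => /MI[-> ?] ->.
by case=> /andP[YE ->] aY; rewrite andbT; apply/MI.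
Qed.

Lemma indep_extend M X Y : X \in indep M -> Y \in indep M -> #|` X| <= #|` Y| ->
  exists Z, [/\ Z \in indep M, X `<=` Z, Z `<=` X `|` Y & #|` Z| = #|` Y|].
Proof.
have [_ _ _ Ia] := matroidP M.
move=> XI YI; have [n] := ubnP (#|` Y| - #|` X|); elim: n X XI => // n IHn X XI.
rewrite ltnS => Xn; rewrite leq_eqVlt => /orP[/eqP XY|XY].
  by exists X; rewrite fsubsetUl.
have [y] := Ia _ _ XI YI XY; rewrite inE => /andP[yX yY] yXI.
have cyX : #|` y |` X| = #|` X|.+1 by rewrite cardfsU1 yX.
have [||Z [ZI XZ ZXY cZ]] := IHn _ yXI; rewrite ?cyX //.
  by rewrite subnS; apply: leq_trans Xn; rewrite prednK ?subn_gt0.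
exists Z; split=> //; first exact: fsubset_trans (fsubsetU1 _ _) XZ.
apply: fsubset_trans ZXY _; rewrite -fsetUA fsubUset fsub1set inE yY orbT.
exact: fsubset_refl.
Qed.

(** Extend C0 inside a basis of the union of X and C. As C0 is a basis of C, the extension Z meets C
    only in C0, so it lies in the union of X and C0 and by cardinality equals it. *)
Lemma contract_indepE M C C0 X : C0 \in indep M -> C0 `<=` C ->
  #|` C0| = rk M C -> X `<=` ground M `\` C ->
  (X \in contract_indep M C) = (X `|` C0 \in indep M).
Proof.
have [_ _ Ih _] := matroidP M.
move=> C0I C0C cC0 XE; rewrite !inE /= fpowersetE XE /=.
have XC x : x \in X -> x \notin C by move/(fsubsetP XE); rewrite inE => /andP[].
have cXC0 : #|` X `|` C0| = (#|` X| + #|` C0|)%N.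
  rewrite cardfsU; have -> : X `&` C0 = fset0; last by rewrite cardfs0 subn0.
  apply/fsetP => x; rewrite !inE; apply/negP => /andP[/XC xC].
  by move/(fsubsetP C0C); apply/negP.
rewrite eqn_leq rk_addl /= -cC0; apply/idP/idP => [rX|XI]; last first.
  by rewrite -cXC0 rk_ge // fsetUS.
have [Y [YI YXC cY]] := rk_basis M (X `|` C).
have C0Y : #|` C0| <= #|` Y| by rewrite cY (leq_trans _ rX) // leq_addl.
have [Z [ZI C0Z ZC0Y cZ]] := indep_extend C0I YI C0Y.
have ZC : Z `&` C = C0.
  apply/esym/eqP; rewrite eqEfcard fsubsetI C0Z C0C /= cC0.
  by apply: rk_ge; [apply: Ih ZI; apply: fsubsetIl|apply: fsubsetIr].
have ZXC0 : Z `<=` X `|` C0.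
  apply/fsubsetP => z zZ; rewrite inE -ZC inE zZ /=.
  have := fsubsetP ZC0Y _ zZ; rewrite inE => /orP[/(fsubsetP C0C) -> |]; first exact: orbT.
  by move/(fsubsetP YXC); rewrite inE.
suff <- : Z = X `|` C0 by [].
by apply/eqP; rewrite eqEfcard ZXC0 cXC0 cZ cY.
Qed.

(* Contract a basis C0 of C; a transversal s0 avoiding C0 relabels the sets
   B j `\` C0 so that each one contains its label again. *)
Lemma gammoid_contract M C : gammoid M -> gammoid (mcontract M C).
Proof.
move/gammoidP => [V [J [B [[JV JB BV] EV MI]]]].
have [C0 [C0I C0C cC0]] := rk_basis M C.
have [C0E [s0 [s0I s0B]]] := (MI C0).1 C0I.
have [t s0t] := left_inverse_on s0I.
apply/gammoidP; exists (V `\` C0), (s0 @` J), (fun k => B (t k) `\` C0); split.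
- split.
  + apply/fsubsetP => _ /imfsetP[j /= jJ ->]; have := s0B j jJ.
    by rewrite !inE => /andP[-> /(fsubsetP (BV j jJ))].
  + by move=> _ /imfsetP[j /= jJ ->]; rewrite s0t // s0B.
  + move=> _ /imfsetP[j /= jJ ->]; rewrite s0t //.
    exact: fsetSD (BV j jJ).
- apply/fsubsetP => x; rewrite !inE => /andP[xC xE]; rewrite (fsubsetP EV) // andbT.
  by apply: contra xC; apply: (fsubsetP C0C).
move=> X /=; have [XE|XE] := boolP (X `<=` ground M `\` C); last first.
  by split=> [|[]//]; rewrite !inE /= fpowersetE (negPf XE).
rewrite (contract_indepE C0I C0C cC0 XE) MI.
have XCE : X `|` C0 `<=` ground M.
  by rewrite fsubUset C0E andbT (fsubset_trans XE) // fsubsetDl.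
split=> -[_ [s [sI sB]]]; split=> //.
  exists (s \o t); split=> [_ _ /imfsetP[i /= iJ ->] /imfsetP[j /= jJ ->]|].
    by rewrite !s0t // => /sI ->.
  move=> _ /imfsetP[j /= jJ ->]; rewrite !s0t //; have := sB j jJ.
  by rewrite !inE negb_or => /andP[/andP[-> ->] ->].
exists (s \o s0); split=> [i j iJ jJ /= /sI|j jJ /=].
  by rewrite !in_imfset // => /(_ isT isT) /s0I; apply.
have := sB (s0 j); rewrite in_imfset // s0t // => /(_ isT).
by rewrite !inE negb_or => /and3P[-> -> ->].
Qed.

Lemma gammoid_minor M N : minor_of N M -> gammoid M -> gammoid N.
Proof.
by case=> C [X [_ _ ->]] gM; apply/gammoid_restrict/gammoid_contract.
Qed.

Lemma matroid_eq M N : ground M = ground N -> indep M = indep N -> M = N.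
Proof.
case: M N => [E I MP] [E' I' NP] /= EE II; rewrite -EE -II in NP *.
by rewrite (Prop_irrelevance MP NP).
Qed.

(** Contract the empty set and restrict to the whole ground set. This places the goal in the domain
    of the equivalence relation. *)
Lemma minor_refl M : minor_of M M.
Proof.
have [IE I0 _ _] := matroidP M.
have r0 : rk M fset0 = 0 by apply/eqP; rewrite -leqn0 -(@cardfs0 K);
  have [Y [_ + <-]] := rk_basis M fset0; rewrite fsubset0 => /eqP ->.
exists fset0, (ground M); split; rewrite ?fsub0set ?fsetD0 //.
apply: matroid_eq => /=; first by rewrite fsetD0 fsetIid.
apply/fsetP => X.
have -> : (X \in restrict_indep (mcontract M fset0) (ground M)) =
    (X \in contract_indep M fset0) && (X `<=` ground M) by rewrite !inE.
have [XE|XE] := boolP (X `<=` ground M); last first.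
  by rewrite andbF; apply/negP => /IE; apply/negP.
rewrite andbT (@contract_indepE M fset0 fset0) ?fsub0set ?cardfs0 ?r0 ?fsetD0 //.
by rewrite fsetU0.
Qed.

End GammoidClosure.

(** * Essential vertices *)

Lemma minimizer (T : Type) (P : T -> Prop) (mu : T -> nat) :
  (exists x, P x) -> exists2 x, P x & forall y, P y -> mu x <= mu y.
Proof.
case=> x Px; have [n] := ubnP (mu x); elim: n x Px => // n IHn x Px xn.
have [[y Py yx]|nex] := pselect (exists2 y, P y & mu y < mu x).
  by apply: (IHn y Py); apply: leq_trans yx _.
exists x => // y Py; rewrite leqNgt; apply/negP => yx.
by apply: nex; exists y.
Qed.

Section Essential.
Variables (K : choiceType) (V J E : {fset K}) (B : K -> {fset K}).
Hypothesis VJB : presentation V J B.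
Hypothesis EV : E `<=` V.
Implicit Types A U : {fset K}.

(** U0 only supplies a bound. Choosing it with minimum rim gives the weakest condition, so v is
    essential when it lies on all minimum separators, of the form rim U, between some A inside E and
    the targets. *)
Definition essential (v : K) : Prop :=
  exists A U0, [/\ A `<=` E, A `<=` U0, U0 `<=` V &
    forall U, A `<=` U -> U `<=` V -> #|` rim J B U| <= #|` rim J B U0| ->
      v \in rim J B U].

Lemma rim_ground : rim J B V = V `\` J.
Proof.
have [_ _ BV] := VJB; apply/fsetP => u; rewrite rimE !inE.
by have [/BV ->|_] := boolP (u \in J); rewrite ?andbF ?andbT.
Qed.

(** Minimise the rim over sets containing A, then maximise |U| among the minimisers: every proper
    superset of U then has a strictly larger rim. V itself, whose rim is the target set, bounds the
    minimum. *)
Lemma essential_witness v : essential v ->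
  exists A U, [/\ A `<=` E, A `<=` U, U `<=` V, #|` rim J B U| <= #|` V `\` J| &
    (forall U', A `<=` U' -> U' `<=` V -> #|` rim J B U'| <= #|` rim J B U| ->
       v \in rim J B U') /\
    (forall U', U `<` U' -> U' `<=` V -> #|` rim J B U| < #|` rim J B U'|)].
Proof.
case=> A [U0 [AE AU0 U0V ess]].
have AV := fsubset_trans AE EV.
have [|U1 [AU1 U1V] min1] :=
    @minimizer _ (fun U => A `<=` U /\ U `<=` V) (fun U => #|` rim J B U|).
  by exists U0.
have [|U [AU UV UU1] min2] := @minimizer _
    (fun U => [/\ A `<=` U, U `<=` V & #|` rim J B U| <= #|` rim J B U1|])
    (fun U => #|` V| - #|` U|)%N.
  by exists U1.
have minU U' : A `<=` U' -> U' `<=` V -> #|` rim J B U| <= #|` rim J B U'|.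
  by move=> AU' U'V; apply: leq_trans UU1 (min1 _ _).
exists A, U; split=> //; first by rewrite -rim_ground minU.
split=> U' UU' U'V.
  by move=> U'U; apply: ess => //; apply: leq_trans U'U (minU _ _ _).
rewrite ltnNge; apply/negP => U'U.
have AU' := fsubset_trans AU (fproper_sub UU').
have /min2 : [/\ A `<=` U', U' `<=` V & #|` rim J B U'| <= #|` rim J B U1|].
  by split=> //; apply: leq_trans U'U UU1.
rewrite leqNgt ltn_sub2l //; last exact: fproper_ltn_card.
by apply: leq_trans (fproper_ltn_card UU') (fsubset_leq_card U'V).
Qed.

Local Open Scope ring_scope.
Variables (F : fieldType) (b : K -> K -> F).
Hypothesis bB : forall j w, w \notin B j -> b j w = 0.
Hypothesis bgen : forall (J' : {fset K}) s, {in J' &, injective s} -> J' `<=` V ->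
  (forall j, j \in J' -> s j \in B j `&` V) ->
  exists h : K -> K -> F,
    (forall i j, i \in J' -> j \in J' ->
       \sum_(l <- J') b i (s l) * h l j = (i == j)%:R) /\
    (forall i j, i \in J' -> j \in J' ->
       \sum_(l <- J') h i l * b l (s j) = (i == j)%:R).

(** Rows inner to U live on columns in U, where [y] vanishes. The remaining rows J2 have a
    transversal [s] avoiding U and w; adding column w gives one column more than rows, hence a
    kernel vector. *)
Lemma kernel_vector U w : U `<=` V -> w \in V -> w \notin U ->
  (forall U', w |` U `<=` U' -> U' `<=` V ->
     (#|` rim J B U| < #|` rim J B U'|)%N) ->
  exists y : K -> F, [/\ forall u, u \in U -> y u = 0, y w != 0 &
    forall j, j \in J -> \sum_(c <- V) b j c * y c = 0].
Proof.
have [JV JB BV] := VJB => UV wV wU tight.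
pose J2 := J `\` inner J B U.
have J2J j : j \in J2 -> j \in J by rewrite inE => /andP[].
have J2V : J2 `<=` V by apply: fsubset_trans JV; apply: fsubsetDl.
have [J' J'J2|s [sI sB]] := @hall K K id J2 (fun j => B j `\` (w |` U)).
  set N := \bigcup_(j <- J') _.
  have NV : N `<=` V `\` (w |` U).
    apply/fsubsetP => x /bigfcupP[j]; rewrite andbT => /(fsubsetP J'J2)/J2J/BV BjV.
    by apply: (fsubsetP (fsetSD _ BjV)).
  have wUV : w |` U `<=` V by rewrite fsubUset fsub1set wV.
  (* The strict inequality in [tight] pays for the extra element w, leaving |J'| <= |N|. *)
  have := tight ((w |` U) `|` N) (fsubsetUl _ _); rewrite fsubUset wUV.
  rewrite (fsubset_trans NV (fsubsetDl _ _)) => /(_ isT) tightU.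
  have cU : #|` (w |` U) `|` N| = (#|` U| + 1 + #|` N|)%N.
    rewrite cardfsU cardfsU1 wU addnC [(_ + 1)%N]addnC.
    have -> : (w |` U) `&` N = fset0; last by rewrite cardfs0 subn0 addnC.
    apply/fsetP => x; rewrite inE; apply/negP => /andP[xU /(fsubsetP NV)].
    by rewrite inE xU.
  have inU : inner J B U `|` J' `<=` inner J B ((w |` U) `|` N).
    apply/fsubsetP => j; rewrite inE => /orP[|jJ'].
      rewrite !innerE !inE => /and3P[-> -> BU]; rewrite orbT /=.
      apply: fsubset_trans BU (fsubset_trans (fsubsetU1 _ _) (fsubsetUl _ _)).
    have jJ := J2J _ (fsubsetP J'J2 _ jJ').
    have BjU : B j `<=` (w |` U) `|` N.
      apply/fsubsetP => x xB; rewrite inE; have [//|xU] := boolP (x \in w |` U).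
      by apply/bigfcupP; exists j; rewrite ?jJ' // inE xU.
    by rewrite innerE jJ BjU (fsubsetP BjU) // JB.
  have dJ' : inner J B U `&` J' = fset0.
    apply/fsetP => j; rewrite inE; apply/negP => /andP[jU /(fsubsetP J'J2)].
    by rewrite inE jU.
  have := leq_add tightU (fsubset_leq_card inU).
  rewrite card_rim_inner cU cardfsU dJ' cardfs0 subn0 addSn addnA card_rim_inner.
  by rewrite addn1 addSn ltnS leq_add2l.
have sJ2 j : j \in J2 -> [/\ s j != w, s j \notin U & s j \in B j].
  by move/sB; rewrite !inE negb_or => /andP[/andP[]].
have [||h [_ hb]] := @bgen J2 s sI => //.
  move=> j jJ2; have [_ _ sBj] := sJ2 _ jJ2.
  by rewrite inE sBj (fsubsetP (BV _ (J2J _ jJ2))).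
pose Q := w |` s @` J2.
have wQ : w \notin s @` J2.
  by apply/imfsetP => -[j /= /sJ2[+ _ _] wE]; rewrite -wE eqxx.
have cQ : (#|{: J2}| < #|` Q|)%N.
  by rewrite cardfsU1 wQ card_in_imfset //= -cardfE add1n.
have [y [[q qQ yq] yQ yb]] := underdetermined (fun j : J2 => b (fsval j)) cQ.
have QV : Q `<=` V.
  rewrite fsubUset fsub1set wV; apply/fsubsetP => _ /imfsetP[j /= jJ2 ->].
  by have [_ _ sBj] := sJ2 _ jJ2; rewrite (fsubsetP (BV _ (J2J _ jJ2))).
have yJ2 j : j \in J2 -> \sum_(c <- Q) b j c * y c = 0.
  by move=> jJ2; have := yb [` jJ2].
have y0 u : u \in U -> y u = 0.
  move=> uU; apply: yQ; rewrite in_fset1U negb_or; apply/andP; split.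
    by apply: contraNneq wU => <-.
  by apply/imfsetP => -[j /= /sJ2[_ sU _] uE]; rewrite -uE uU in sU.
exists y; split=> //.
(* If [y w] were 0, the invertible block on J2 and its transversal would force [y] to vanish on all
   of Q. *)
- apply: contraTneq qQ => yw; rewrite in_fset1U negb_or.
  have -> : q != w by apply: contraNneq yq => ->; rewrite yw.
  apply/imfsetP => -[i /= iJ2 qE]; case/eqP: yq; rewrite qE.
  have -> : y (s i) = \sum_(j <- J2) (i == j)%:R * y (s j).
    rewrite (big_fsetD1 i) //= eqxx mul1r big_seq big1 ?addr0 // => j.
    by rewrite !inE => /andP[ji _]; rewrite eq_sym (negPf ji) mul0r.
  have -> : \sum_(j <- J2) (i == j)%:R * y (s j) =
      \sum_(j <- J2) \sum_(l <- J2) h i l * (b l (s j) * y (s j)).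
    rewrite big_seq [RHS]big_seq; apply: eq_bigr => j jJ2; rewrite -hb // mulr_suml.
    by apply: eq_bigr => l _; rewrite mulrA.
  rewrite exchange_big big_seq big1 //= => l lJ2.
  rewrite -mulr_sumr; have := yJ2 l lJ2; rewrite big_fsetU1 //= yw mulr0 add0r.
  by rewrite big_imfset //= => ->; rewrite mulr0.
- move=> j jJ; rewrite -(big_fset_incl _ QV) /=; last first.
    by move=> c _ /yQ ->; rewrite mulr0.
  have [jU|jU] := boolP (j \in inner J B U); last by apply: yJ2; rewrite inE jU.
  rewrite big1 // => c _; have [cU|cU] := boolP (c \in U).
    by rewrite y0 ?mulr0.
  rewrite bB ?mul0r //; apply: contra cU; apply/fsubsetP.
  by move: jU; rewrite innerE => /and3P[].
Qed.

(** P collects the inner rows whose set contains v. Enough of the other inner rows, J1, have a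
    transversal inside U minus A; rows P and J1 outnumber the columns U minus A, and a dependency
    among them cannot live on J1 alone. *)
Lemma cokernel_vector A U v : A `<=` U -> U `<=` V -> v \notin A ->
  (forall U', A `<=` U' -> U' `<=` V ->
     (#|` rim J B U'| <= #|` rim J B U|)%N -> v \in U') ->
  exists (z : K -> F) p, [/\ p \in J, v \in B p, z p != 0,
    forall j, j \notin inner J B U -> z j = 0 &
    forall c, c \in V `\` A -> \sum_(j <- J) z j * b j c = 0].
Proof.
have [JV JB BV] := VJB => AU UV vA essU.
have AV := fsubset_trans AU UV.
have kA : (#|` rim J B U| < #|` A|)%N.
  rewrite ltnNge; apply: contra vA => kA; apply: essU => //.
  apply: leq_trans kA; apply: fsubset_leq_card; exact: fsubsetDl.
(* For J' in J3 with union N outside A, the union of A and N misses v, so its rim exceeds that of U.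
   Counting gives |J'| <= |N| + d with this d. *)
pose d := (#|` A| - #|` rim J B U|).-1.
have dE : (#|` rim J B U| + d.+1)%N = #|` A|.
  by rewrite prednK ?subn_gt0 // subnKC // ltnW.
pose P := [fset p in inner J B U | v \in B p].
have PE x : (x \in P) = (x \in inner J B U) && (v \in B x) by rewrite !inE.
have PI : P `<=` inner J B U by apply/fsubsetP => p; rewrite PE => /andP[].
pose J3 := inner J B U `\` P.
have IJ : inner J B U `<=` J by apply/fsubsetP => j; rewrite innerE => /and3P[].
have J3J j : j \in J3 -> [/\ j \in J, v \notin B j & B j `<=` U].
  rewrite in_fsetD => /andP[jP jI]; move: (jI); rewrite innerE => /and3P[_ -> ->].
  by split=> //; apply: contra jP => vB; rewrite PE jI.
have [J' J'J3|J1 [s [J1J3 J1d sI sB]]] := @hall_deficiency K d J3 (fun j => B j `\` A).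
  set N := \bigcup_(j <- J') _; rewrite leqNgt; apply/negP => Nd.
  have NP x : x \in N -> [/\ x \notin A, x \in V & x != v].
    case/bigfcupP => j; rewrite andbT inE => /(fsubsetP J'J3)/J3J[jJ vB _] /andP[xA xB].
    split=> //; first exact: (fsubsetP (BV _ jJ)).
    by apply: contraNneq vB => <-.
  have : v \in A `|` N.
    apply: essU; first exact: fsubsetUl.
      by rewrite fsubUset AV; apply/fsubsetP => x /NP[].
    have dAN : A `&` N = fset0.
      by apply/fsetP => x; rewrite inE; apply/negP => /andP[xA /NP[]]; rewrite xA.
    have J'I : J' `<=` inner J B (A `|` N).
      apply/fsubsetP => j jJ'; have [jJ _ _] := J3J _ (fsubsetP J'J3 _ jJ').
      have BjU : B j `<=` A `|` N.
        apply/fsubsetP => x xB; rewrite inE; have [//|xA] := boolP (x \in A).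
        by apply/bigfcupP; exists j; rewrite ?jJ' // inE xA.
      by rewrite innerE jJ BjU (fsubsetP BjU) // JB.
    rewrite -(leq_add2r #|` inner J B (A `|` N)|) card_rim_inner cardfsU dAN.
    rewrite cardfs0 subn0 -dE -addnA leq_add2l.
    apply: leq_trans (fsubset_leq_card J'I); apply: leq_trans Nd.
    by rewrite addSn addnC.
  by rewrite inE (negPf vA) => /NP[_ _]; rewrite eqxx.
have J1I : J1 `<=` inner J B U by apply: fsubset_trans J1J3 (fsubsetDl _ _).
pose Q := P `|` J1.
have QI : Q `<=` inner J B U by rewrite fsubUset PI.
have PJ1 : P `&` J1 = fset0.
  apply/fsetP => x; rewrite inE; apply/negP => /andP[xP /(fsubsetP J1J3)].
  by rewrite inE xP.
have cQ : (#|{: U `\` A}| < #|` Q|)%N.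
  rewrite -cardfE cardfsU PJ1 cardfs0 subn0 cardfsD (fsetIidPr AU).
  rewrite -(ltn_add2r #|` A|) subnK ?fsubset_leq_card // -(card_rim_inner J B U) -dE.
  rewrite addnC [(#|` rim J B U| + _)%N]addnC addnA ltn_add2r addnS ltnS.
  rewrite -(leq_add2r 0) addn0 -[leqLHS](subnKC (fsubset_leq_card PI)).
  rewrite -[X in (_ - #|` X|)%N](fsetIidPr PI) -cardfsD -/J3 addn0 -addnA leq_add2l.
  rewrite -[leqLHS](subnKC (fsubset_leq_card J1J3)) leq_add2l.
  by rewrite -[X in (_ - #|` X|)%N](fsetIidPr J1J3) -cardfsD.
have [z [[q qQ zq] zQ zb]] :=
  underdetermined (fun (c : U `\` A) j => b j (fsval c)) cQ.
have zUA c : c \in U `\` A -> \sum_(j <- Q) b j c * z j = 0.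
  by move=> cUA; have := zb [` cUA].
have sJ1 j : j \in J1 -> [/\ j \in J, s j \in B j, s j \in U & s j \notin A].
  move=> jJ1; have := sB _ jJ1; rewrite inE => /andP[sA sBj].
  by have [jJ _ BjU] := J3J _ (fsubsetP J1J3 _ jJ1); rewrite sBj (fsubsetP BjU).
have [||h [bh _]] := @bgen J1 s sI.
- exact: fsubset_trans J1I (fsubset_trans IJ JV).
- by move=> j /sJ1[_ sBj sU _]; rewrite inE sBj (fsubsetP UV).
have [p pP zp] : exists2 p, p \in P & z p != 0.
  apply: contrapT => nP.
  have zP p : p \in P -> z p = 0.
    by move=> pP; apply/eqP/negPn/negP => zp; apply: nP; exists p.
  have qJ1 : q \in J1.
    by move: qQ; rewrite inE => /orP[/zP q0|//]; rewrite q0 eqxx in zq.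
  case/eqP: zq.
  have -> : z q = \sum_(j <- J1) z j * (j == q)%:R.
    rewrite (big_fsetD1 q) //= eqxx mulr1 big_seq big1 ?addr0 // => j.
    by rewrite !inE => /andP[/negPf -> _]; rewrite mulr0.
  have -> : \sum_(j <- J1) z j * (j == q)%:R =
      \sum_(j <- J1) \sum_(l <- J1) b j (s l) * z j * h l q.
    rewrite big_seq [RHS]big_seq; apply: eq_bigr => j jJ1; rewrite -bh // mulr_sumr.
    by apply: eq_bigr => l _; rewrite mulrA [z j * _]mulrC.
  rewrite exchange_big big_seq big1 //= => l lJ1; rewrite -mulr_suml.
  have [_ _ sU sA] := sJ1 _ lJ1.
  have /zUA : s l \in U `\` A by rewrite inE sA.
  rewrite -(@big_fset_incl _ _ _ _ J1 Q) /=; first by move=> ->; rewrite mul0r.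
    exact: fsubsetUr.
  by move=> x; rewrite inE => /orP[/zP ->|->//]; rewrite mulr0.
exists z, p; split=> //.
- exact/(fsubsetP IJ)/(fsubsetP PI).
- by move: pP; rewrite PE => /andP[].
- by move=> j jI; apply: zQ; apply: contra jI; apply/fsubsetP.
move=> c; rewrite inE => /andP[cA cV].
rewrite -(big_fset_incl _ (fsubset_trans QI IJ)) /=; last first.
  by move=> j _ /zQ ->; rewrite mul0r.
have [cU|cU] := boolP (c \in U).
  under eq_bigr do rewrite mulrC.
  by apply: zUA; rewrite inE cA.
rewrite big_seq big1 // => j /(fsubsetP QI); rewrite innerE => /and3P[_ _ BjU].
by rewrite bB ?mulr0 //; apply: contra cU; apply/fsubsetP.
Qed.

End Essential.

(** * The number of essential vertices *)

Section EssentialBound.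
Variables (K : choiceType) (V J E : {fset K}) (B : K -> {fset K}).
Hypothesis VJB : presentation V J B.
Hypothesis EV : E `<=` V.
Local Open Scope ring_scope.

Lemma natr_inj (F : fieldType) : (forall n, n.+1%:R != 0 :> F) ->
  injective (fun n => n%:R : F).
Proof.
move=> F0 m n; wlog mn : m n / (m <= n)%N => [H|].
  by case/orP: (leq_total m n) => [/H//|/H{}H /esym/H].
move=> mnE; apply/eqP; rewrite eqn_leq mn -subn_eq0 /=.
case nm : (n - m)%N => [//|k]; have := F0 k; rewrite -nm natrB //.
by rewrite -mnE subrr eqxx.
Qed.

Lemma card_essential :
  (forall v, v \in J `\` E -> essential V J E B v) ->
  (#|` J `\` E| <= #|` V `\` J| ^ 2 * #|` E|)%N.
Proof.
move=> ess; have [JV JB BV] := VJB.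
have BVs j w : j \in J -> w \in B j -> w \in V by move/BV/fsubsetP; apply.
have [F [b [F0 bB bgen]]] := generic_coefficients V B.
pose S := J `\` E; pose T := V `\` J.
pose zeta u : F := (index u (enum_fset V))%:R.
have zetaI : {in V &, injective zeta}.
  move=> u v uV vV /(natr_inj F0) uv.
  by rewrite -(nth_index u uV) uv nth_index.
(* As j lies in B j, the identity is a transversal, and [h] inverts the block of [b] on J x J. *)
have [//||h [bh hb]] := @bgen J id _ JV.
  by move=> j jJ; rewrite inE JB // (fsubsetP JV).
(* Solving the kernel equations for the coordinates in J: y on J is minus the inverse block times
   the block on T applied to y on T. *)
pose eta t w := if w \in J then - \sum_(i <- J) h w i * b i t else (w == t)%:R.
have etaE (y : K -> F) w : (forall j, j \in J -> \sum_(c <- V) b j c * y c = 0) ->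
    w \in V -> y w = \sum_(t <- T) y t * eta t w.
  move=> yb wV; rewrite /eta; have [wJ|wJ] := boolP (w \in J); last first.
    rewrite (big_fsetD1 w) /=; last by rewrite inE wJ.
    rewrite eqxx mulr1 big_seq big1 ?addr0 // => t.
    by rewrite !inE => /andP[tw _]; rewrite eq_sym (negPf tw) mulr0.
  have VT : T `<=` V by apply: fsubsetDl.
  have split_sum i : \sum_(c <- V) b i c * y c =
      \sum_(c <- J) b i c * y c + \sum_(t <- T) b i t * y t.
    rewrite (big_fsetID _ (mem J)) /=; congr (_ + _); apply: eq_fbigl => x.
      by rewrite !inE /=; case: (boolP (x \in J)) => [/(fsubsetP JV) ->|_]; rewrite ?andbF.
    by rewrite !inE /= andbC.
  have -> : y w = \sum_(j <- J) (w == j)%:R * y j.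
    rewrite (big_fsetD1 w) //= eqxx mul1r big_seq big1 ?addr0 // => j.
    by rewrite !inE => /andP[ji _]; rewrite eq_sym (negPf ji) mul0r.
  have -> : \sum_(j <- J) (w == j)%:R * y j =
      \sum_(j <- J) \sum_(i <- J) h w i * (b i j * y j).
    rewrite big_seq [RHS]big_seq; apply: eq_bigr => j jJ; rewrite -hb // mulr_suml.
    by apply: eq_bigr => i _; rewrite mulrA.
  rewrite exchange_big /=.
  have -> : \sum_(i <- J) \sum_(j <- J) h w i * (b i j * y j) =
      \sum_(i <- J) \sum_(t <- T) - (h w i * (b i t * y t)).
    rewrite big_seq [RHS]big_seq; apply: eq_bigr => i iJ.
    rewrite -mulr_sumr sumrN -mulr_sumr -mulrN; congr (_ * _).
    by apply/eqP; rewrite -addr_eq0 -split_sum yb.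
  rewrite exchange_big /=; apply: eq_bigr => t _.
  rewrite sumrN mulrN mulr_sumr; congr (- _); apply: eq_bigr => i _.
  by rewrite mulrA mulrC.
(* A vector z on J is recovered from the J-columns of z b through [h]; when z b vanishes off E, only
   columns in both E and J contribute. *)
pose h' e p := if e \in J then h e p else 0.
have h'E (z : K -> F) p : (forall c, c \in V `\` E -> \sum_(j <- J) z j * b j c = 0) ->
    p \in J -> z p = \sum_(e <- E) (\sum_(j <- J) z j * b j e) * h' e p.
  move=> zb pJ; pose phi c := \sum_(j <- J) z j * b j c.
  rewrite (@big_fset_incl _ _ _ _ E V) //=; last first.
    by move=> c cV cE; rewrite zb ?mul0r // inE cE.
  rewrite -(@big_fset_incl _ _ _ _ J V) //=; last first.
    by move=> c _ /negPf cJ; rewrite /h' cJ mulr0.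
  have -> : z p = \sum_(j <- J) z j * (j == p)%:R.
    rewrite (big_fsetD1 p) //= eqxx mulr1 big_seq big1 ?addr0 // => j.
    by rewrite !inE => /andP[/negPf -> _]; rewrite mulr0.
  have -> : \sum_(j <- J) z j * (j == p)%:R =
      \sum_(j <- J) \sum_(i <- J) z j * b j i * h i p.
    rewrite big_seq [RHS]big_seq; apply: eq_bigr => j jJ; rewrite -bh // mulr_sumr.
    by apply: eq_bigr => i _; rewrite mulrA.
  rewrite exchange_big big_seq [RHS]big_seq /=; apply: eq_bigr => i iJ.
  by rewrite /h' iJ -mulr_suml.
(* [eta] and [h'] express [y_v] through its values on T and [z_v] through the
   values of [z_v b] on E: this bounds the rank by |T| * |T| * |E|. *)
have wit v : exists x : ({fset K} * (K -> F) * (K -> F) * (K * K)), v \in S ->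
    let: (U, y, z, (w, p)) := x in
    [/\ v \in rim J B U, U `<=` V & (#|` rim J B U| <= #|` T|)%N] /\
    [/\ w \in B v, y w != 0, forall u, u \in U -> y u = 0 &
        forall j, j \in J -> \sum_(c <- V) b j c * y c = 0] /\
    [/\ p \in J, v \in B p, z p != 0, forall j, j \notin inner J B U -> z j = 0 &
        forall c, c \in V `\` E -> \sum_(j <- J) z j * b j c = 0].
  have [vS|vS] := boolP (v \in S); last first.
    (* Arbitrary values outside S make the relation total for [choice]. *)
    by exists (fset0, fun=> 0, fun=> 0, (v, v)).
  have [vE vJ] : v \notin E /\ v \in J by move: vS; rewrite inE => /andP[].
  have [A [U [AE AU UV UT [essU maxU]]]] := essential_witness VJB EV (ess v vS).
  have vU : v \in rim J B U by apply: essU.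
  have vA : v \notin A by apply: contra vE; apply: (fsubsetP AE).
  have [w wB wU] : exists2 w, w \in B v & w \notin U.
    apply/fsubsetPn; move: vU; rewrite rimE vJ /= => /andP[_].
    by [].
  have wV := BVs _ _ vJ wB.
  have [|y [yU yw yb]] := kernel_vector VJB bB bgen UV wV wU.
    move=> U' wU'; apply: maxU.
    rewrite fproperE (fsubset_trans (fsubsetU1 w U) wU') /=.
    apply: contra wU => /fsubsetP; apply; apply: (fsubsetP wU').
    by rewrite !inE eqxx.
  have [|z [p [pJ vB zp zU zb]]] := cokernel_vector VJB bB bgen AU UV vA.
    move=> U' AU' U'V U'U; have := essU U' AU' U'V U'U.
    by rewrite rimE => /andP[].
  exists (U, y, z, (w, p)) => _ /=; split=> //; split=> //; split=> // c.
  by rewrite inE => /andP[cE cV]; apply: zb; rewrite inE cV andbT;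
     apply: contra cE; apply: (fsubsetP AE).
have {wit} [f fP] := choice wit.
pose U_ v := (f v).1.1.1; pose y_ v := (f v).1.1.2; pose z_ v := (f v).1.2.
pose w_ v := (f v).2.1; pose p_ v := (f v).2.2.
have {fP} SP v : v \in S ->
    [/\ v \in rim J B (U_ v), U_ v `<=` V & (#|` rim J B (U_ v)| <= #|` T|)%N] /\
    [/\ w_ v \in B v, y_ v (w_ v) != 0, forall u, u \in U_ v -> y_ v u = 0 &
        forall j, j \in J -> \sum_(c <- V) b j c * y_ v c = 0] /\
    [/\ p_ v \in J, v \in B (p_ v), z_ v (p_ v) != 0,
        forall j, j \notin inner J B (U_ v) -> z_ v j = 0 &
        forall c, c \in V `\` E -> \sum_(j <- J) z_ v j * b j c = 0].
  move/fP; rewrite /U_ /y_ /z_ /w_ /p_.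
  by case: (f v) => [[[U y] z] [w p]].
have SJ v : v \in S -> v \in J by rewrite inE => /andP[].
(* Omitting v leaves at most |T| - 1 roots, so [al v] has at most |T| coefficients. *)
pose al v := \prod_(a <- [seq zeta c | c <- rim J B (U_ v) `\ v]) ('X - a%:P).
have alP v u : v \in S -> u \in V -> (al v).[zeta u] == 0 = (u \in rim J B (U_ v) `\ v).
  move=> vS uV; rewrite -[_ == 0]/(root _ _) root_prod_XsubC.
  have [[_ UV _] _] := SP v vS; apply/mapP/idP => [[c cU /zetaI -> //]|uU]; last by exists u.
  apply: (fsubsetP UV); move: cU; rewrite in_fsetD1 rimE.
  by case/and3P.
have al_size v : v \in S -> (size (al v) <= #|` T|)%N.
  move=> vS; have [[vU _ UT] _] := SP v vS; apply: leq_trans UT.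
  by rewrite size_prod_XsubC size_map (cardfsD1 v (rim _ _ _)) vU.
(* If u is outside [U_ v], the row [p_ u] is not inner and [z_ v] vanishes there; if B u lies
   inside, [y_ v] vanishes at [w_ u]; otherwise u is on the rim and is a root of [al v]. *)
have off v u : v \in S -> u \in S -> u != v ->
    (al v).[zeta u] * y_ v (w_ u) * z_ v (p_ u) = 0.
  move=> vS uS uv; have [[vU UV _] [[_ _ yU _] [_ _ _ zU _]]] := SP v vS.
  have [_ [[wB _ _ _] [pJ uB _ _ _]]] := SP u uS.
  have uV : u \in V by apply: (fsubsetP JV); apply: SJ.
  have [uU|uU] := boolP (u \in U_ v); last first.
    rewrite zU ?mulr0 //; apply: contra uU; rewrite innerE => /and3P[_ _ /fsubsetP].
    exact.
  have [BU|BU] := boolP (B u `<=` U_ v).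
    by rewrite yU ?(fsubsetP BU) // mulr0 mul0r.
  have /eqP -> : (al v).[zeta u] == 0.
    by rewrite alP // in_fsetD1 uv rimE uU (negPf BU) andbF.
  by rewrite !mul0r.
(* If S were too large, a nonzero [c] on S would be orthogonal to all products of a power of [zeta],
   an [eta] and an [h']. These span the rows of the diagonal matrix, so the row of a v with [c v]
   nonzero gives a contradiction. *)
rewrite leqNgt; apply/negP => Slt.
have cS : (#|{: 'I_#|` T| * T * E}| < #|` S|)%N.
  by rewrite !card_prod card_ord -!cardfE mulnn.
have [c [[v vS cv] _ eqs]] := underdetermined
  (fun k u => zeta u ^+ (k.1.1 : 'I_#|` T|) * eta (fsval k.1.2) (w_ u) * h' (fsval k.2) (p_ u)) cS.
have [[vU UV _] [[wB yw yU yb] [pJ vB zp zU zb]]] := SP v vS.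
have vV : v \in V by apply: (fsubsetP JV); apply: SJ.
have : \sum_(u <- S) (al v).[zeta u] * y_ v (w_ u) * z_ v (p_ u) * c u = 0.
  pose phi e := \sum_(j <- J) z_ v j * b j e.
  have triple (G : 'I_#|` T| -> T -> E -> F) :
      \sum_(k : 'I_#|` T| * T * E) G k.1.1 k.1.2 k.2 =
      \sum_i \sum_(t : T) \sum_(e : E) G i t e.
    rewrite (pair_bigA _ (fun i t => \sum_(e : E) G i t e)) /=.
    by rewrite (pair_bigA _ (fun it e => G it.1 it.2 e)).
  have -> : \sum_(u <- S) (al v).[zeta u] * y_ v (w_ u) * z_ v (p_ u) * c u =
      \sum_(u <- S) \sum_(k : 'I_#|` T| * T * E)
        ((al v)`_(k.1.1) * y_ v (fsval k.1.2) * phi (fsval k.2)) *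
        (zeta u ^+ k.1.1 * eta (fsval k.1.2) (w_ u) * h' (fsval k.2) (p_ u) * c u).
    rewrite big_seq [RHS]big_seq; apply: eq_bigr => u uS.
    have [_ [[wuB _ _ _] [puJ _ _ _ _]]] := SP u uS.
    rewrite (horner_coef_wide _ (al_size v vS)) (etaE _ _ yb (BVs _ _ (SJ _ uS) wuB)).
    rewrite (h'E _ _ zb puJ) !big_seq_fsetE /=.
    rewrite (triple (fun i t e => (al v)`_i * y_ v (fsval t) * phi (fsval e) *
      (zeta u ^+ i * eta (fsval t) (w_ u) * h' (fsval e) (p_ u) * c u))).
    rewrite !mulr_suml; apply: eq_bigr => i _.
    rewrite [X in X * _ * _]mulr_sumr !mulr_suml; apply: eq_bigr => t _.
    rewrite mulr_sumr mulr_suml; apply: eq_bigr => e _.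
    by rewrite (mulrACA (_`_ _)) (mulrACA (_`_ _ * _)) [RHS]mulrA.
  rewrite exchange_big /= big1 // => k _; rewrite -mulr_sumr.
  by rewrite (eqs k) mulr0.
rewrite (big_fsetD1 v) //= big_seq big1 ?addr0 => [|u]; last first.
  by rewrite in_fsetD1 => /andP[uv uS]; rewrite off // mul0r.
apply/eqP; rewrite !mulf_neq0 // alP // in_fsetD1 eqxx.
by [].
Qed.

End EssentialBound.

(** * Small presentations *)

Section SmallPresentation.
Variable K : choiceType.
Implicit Types (V J E U X : {fset K}) (B : K -> {fset K}) (M : matroid K).

(* Deleting v and joining its in-neighbours to its out-neighbours. *)
Lemma bypass V J E B v : presentation V J B -> E `<=` V ->
  v \in J `\` E -> ~ essential V J E B v ->
  let B' u := if v \in B u then (B u `|` B v) `\ v else B u in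
  presentation (V `\ v) (J `\ v) B' /\
  forall X, X `<=` E -> avoidable (J `\ v) B' X <-> avoidable J B X.
Proof.
move=> VJB EV; rewrite inE => /andP[vE vJ] ness B'; have [JV JB BV] := VJB.
have B'E u w : (w \in B' u) =
    if v \in B u then (w != v) && ((w \in B u) || (w \in B v)) else w \in B u.
  by rewrite /B'; case: ifP => // _; rewrite !inE.
have P' : presentation (V `\ v) (J `\ v) B'.
  split; first exact: fsetSD.
  - move=> j; rewrite in_fsetD1 => /andP[jv jJ].
    by rewrite B'E jv JB // if_same.
  - move=> j; rewrite in_fsetD1 => /andP[jv jJ]; apply/fsubsetP => w.
    rewrite B'E in_fsetD1; case: ifP => vB.
      by case/andP => -> /orP[]; apply/fsubsetP/BV.
    move=> wB; rewrite (fsubsetP (BV _ jJ)) // andbT.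
    by apply: contraFneq vB => <-.
split=> // X XE.
have XV := fsubset_trans XE EV.
have vX : v \notin X by apply: contra vE; apply: (fsubsetP XE).
have XV' : X `<=` V `\ v by rewrite fsubsetD1 XV.
rewrite (avoidableP P' XV') (avoidableP VJB XV); split=> aX U XU UV.
  (* As v is not essential, U can be replaced by a U' of no larger rim that does not have v on its
     rim; removing v from U' then adds nothing to the rim in the new family. *)
  have [U' [XU' U'V U'U vU']] : exists U', [/\ X `<=` U', U' `<=` V,
      #|` rim J B U'| <= #|` rim J B U| & v \notin rim J B U'].
    apply: contrapT => nU'; apply: ness; exists X, U; split=> // U' XU' U'V U'U.
    by apply/negPn/negP => vU'; apply: nU'; exists U'.
  have XU'v : X `<=` U' `\ v by rewrite fsubsetD1 XU'.
  apply: leq_trans (aX _ XU'v (fsetSD _ U'V)) (leq_trans _ U'U).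
  apply/fsubset_leq_card/fsubsetP => u; rewrite !rimE !in_fsetD1.
  case/andP => /andP[uv ->] /=; rewrite uv /=; apply: contra => /andP[-> BU'] /=.
  apply/fsubsetP => w; rewrite B'E in_fsetD1; case: ifP => vB; last first.
    move=> wB; rewrite (fsubsetP BU') // andbT.
    by apply: contraFneq vB => <-.
  case/andP => -> /orP[/(fsubsetP BU') //|].
  move: vU'; rewrite rimE (fsubsetP BU') // vJ /= negbK => /fsubsetP; apply.
have UV' : U `<=` V by apply: fsubset_trans UV (fsubD1set _ _).
have vU : v \notin U by move: UV; rewrite fsubsetD1 => /andP[].
(* If B v fits, v joins U as an inner vertex. If not, an in-neighbour of v is on the new rim anyway,
   and U itself serves. *)
have [BvU|BvU] := boolP (B v `<=` v |` U).
  have XvU : X `<=` v |` U by apply: fsubset_trans XU (fsubsetU1 _ _).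
  have vUV : v |` U `<=` V by rewrite fsubUset fsub1set (fsubsetP JV).
  apply: leq_trans (aX _ XvU vUV) _.
  apply/fsubset_leq_card/fsubsetP => u; rewrite !rimE in_fset1U.
  have [->|uv] /= := eqVneq u v; first by rewrite vJ BvU.
  case/andP => -> /=; apply: contra; rewrite in_fsetD1 uv /= => /andP[-> B'U] /=.
  apply/fsubsetP => w wB; rewrite in_fset1U; have [//|wv] /= := eqVneq w v.
  by apply: (fsubsetP B'U); rewrite B'E wv wB if_same.
apply: leq_trans (aX _ XU UV') _.
apply/fsubset_leq_card/fsubsetP => u; rewrite !rimE in_fsetD1.
case/andP => -> /=; apply: contra => /andP[/andP[uv ->] B'U] /=.
apply/fsubsetP => w wB; apply: (fsubsetP B'U); rewrite B'E wB /=.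
case: ifP => // vB; case/negP: BvU; apply/fsubsetP => x xB.
rewrite in_fset1U; have [//|xv] /= := eqVneq x v.
by apply: (fsubsetP B'U); rewrite B'E vB xv xB orbT.
Qed.

(** A basis I of the ground set is spanning, so some U around the ground set has rim |I|. Keeping
    only U, with its rim as the new target set, does not change M. *)
Lemma presents_rank V J B M : presents V J B M ->
  exists V' J', presents V' J' B M /\ #|` V' `\` J'| = rk M (ground M).
Proof.
case=> VJB EV MI; have [JV JB BV] := VJB.
set E := ground M in EV MI *.
have [I [II IE cI]] := rk_basis M E.
have [_ aI] := (MI I).1 II.
have [|U [EU UV Uk]] := avoidable_span VJB (fsubset_trans IE EV) EV aI.
  move=> y; rewrite inE => /andP[yI yE] ayI.
  have /MI yII : y |` I `<=` E /\ avoidable J B (y |` I).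
    by rewrite fsubUset IE fsub1set yE.
  have /(rk_ge (M := M) yII) : y |` I `<=` E by rewrite fsubUset IE fsub1set yE.
  by rewrite cardfsU1 yI -/E -cI add1n ltnn.
have {}EU : E `<=` U by apply: fsubset_trans (fsubsetUr _ _) EU.
have minE U' : E `<=` U' -> U' `<=` V -> #|` I| <= #|` rim J B U'|.
  by move=> EU'; apply: (avoidableP VJB (fsubset_trans IE EV)).1 (fsubset_trans IE EU').
have P' : presentation U (inner J B U) B.
  split=> [|j|j]; first exact: inner_sub.
    by rewrite innerE => /and3P[_ /JB].
  by rewrite innerE => /and3P[].
exists U, (inner J B U); split; last first.
  by apply/eqP; rewrite eqn_leq -cI Uk minE.
split=> // X; rewrite MI; split=> -[XE aX]; split=> //.
  have [s [sI sB]] := aX.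
  have iJ j : j \in inner J B U -> j \in J by rewrite innerE => /and3P[].
  by exists s; split=> [i j /iJ iI /iJ|j /iJ]; [apply: sI|apply: sB].
have XV := fsubset_trans XE EV; have XU := fsubset_trans XE EU.
apply/(avoidableP VJB XV) => U' XU' U'V.
(* The union of U and U' contains the ground set, so its rim is at least that of U; by submodularity
   the intersection has rim at most that of U'. *)
have XUU' : X `<=` U `&` U' by rewrite fsubsetI XU.
have := (avoidableP P' XU).1 aX _ XUU' (fsubsetIl _ _).
have -> : rim (inner J B U) B (U `&` U') = rim J B (U `&` U').
  apply/fsetP => u; rewrite !rimE innerE inE; case: (u \in U) => //=.
  case: (u \in U') => //=; case: (u \in J) => //=.
  by rewrite fsubsetI andbA andbb.
move/leq_trans; apply; rewrite -(leq_add2r #|` rim J B (U `|` U')|).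
apply: leq_trans (rim_submod _ _ _ _) _; rewrite addnC leq_add2l.
apply: leq_trans Uk (minE _ _ _); last by rewrite fsubUset UV.
exact: fsubset_trans EU (fsubsetUl _ _).
Qed.

(** Among presentations with rank many targets take one with fewest vertices. Bypassing keeps the
    target set, so minimality makes every vertex of J outside the ground set essential, and
    [card_essential] applies. *)
Lemma small_presentation M : gammoid M ->
  exists V J B, presents V J B M /\
    #|` V| <= rk M (ground M) ^ 2 * #|` ground M| + rk M (ground M) + #|` ground M|.
Proof.
move/gammoidP => [V0 [J0 [B0 P0]]].
have [V1 [J1 [P1 r1]]] := presents_rank P0.
have [|[[V J] B] /= [P r] minV] := @minimizer _
  (fun x : {fset K} * {fset K} * (K -> {fset K}) =>
     presents x.1.1 x.1.2 x.2 M /\ #|` x.1.1 `\` x.1.2| = rk M (ground M))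
  (fun x => #|` x.1.1|).
  by exists (V1, J1, B0).
exists V, J, B; split=> //; have [VJB EV MI] := P; have [JV _ _] := VJB.
have ess v : v \in J `\` ground M -> essential V J (ground M) B v.
  move=> vJ; apply: contrapT => ness; have := bypass VJB EV vJ ness.
  set B' := fun u => _; move=> [P' aE]; move: vJ; rewrite inE => /andP[vE vJ].
  have VJE : (V `\ v) `\` (J `\ v) = V `\` J.
    by apply/fsetP => u; rewrite !inE; have [->|uv] := eqVneq u v; rewrite ?vJ ?andbF.
  suff /(minV (V `\ v, J `\ v, B')) /= : presents (V `\ v) (J `\ v) B' M /\
      #|` (V `\ v) `\` (J `\ v)| = rk M (ground M).
    by rewrite (cardfsD1 v V) (fsubsetP JV) // add1n ltnn.
  rewrite VJE; split=> //; split=> //; first by rewrite fsubsetD1 EV.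
  by move=> X; rewrite MI; split=> -[XE /aE]; move=> /(_ XE).
have := card_essential VJB EV ess; rewrite r => cJ.
have cV : V `<=` (J `\` ground M) `|` (V `\` J) `|` ground M.
  by apply/fsubsetP => u uV; rewrite !inE uV; case: (u \in J); case: (u \in ground M).
apply: leq_trans (fsubset_leq_card cV) _.
rewrite cardfsU; apply: leq_trans (leq_subr _ _) _; rewrite leq_add2r.
rewrite cardfsU; apply: leq_trans (leq_subr _ _) _.
by rewrite r leq_add2r.
Qed.

(* The elements of Z become isolated targets, hence coloops. *)
Lemma strict_extension (Kinf : infinite_set [set: K]%classic) V J B M m :
  presents V J B M -> #|` V| <= m ->
  exists N, [/\ extension_of N M, #|` ground N| = m & strict_gammoid N].
Proof.
move=> [[JV JB BV] EV MI] Vm; have [Z cZ ZV] := fresh_fset Kinf V (m - #|` V|).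
have P' : presentation (V `|` Z) J B.
  split=> //; first exact: fsubset_trans JV (fsubsetUl _ _).
  by move=> j /BV jV; apply: fsubset_trans jV (fsubsetUl _ _).
have EVZ := fsubset_trans EV (fsubsetUl V Z).
exists (cotransversal P'); split.
- split=> //=; apply/fsetP => X; rewrite !inE /=; apply/idP/andP.
    move/MI => [XE aX]; split=> //; rewrite fpowersetE (fsubset_trans XE) //=.
    exact/asboolP.
  by case=> /andP[_ /asboolP aX] XE; apply/MI.
- by rewrite /= cardfsU fsetIC (eqP ZV) cardfs0 subn0 cZ subnKC.
apply/strict_gammoidP; exists J, B; split=> //= X.
exact: cotransversal_indepE.
Qed.

End SmallPresentation.

(** * Validity of the conclusion tableau *)

Theorem corollary3p10 (K : choiceType) (Kinf : infinite_set [set: K]%classic)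
    (T T' : tableau K) :
  matroid_tableau T -> decisive T -> conclusion_tableau T T' ->
  matroid_tableau T' /\ valid T'.
Proof.
move=> eqT [[gT sT nT cT] _] [goalE strictE equivE cases].
have [eqdom eqrefl _ _] := eqT.
(* Once the domain is known to be unchanged, the equivalence relation and condition (iv) carry over
   verbatim. *)
suff [domE gT' nT'] : [/\ tableau_dom T' = tableau_dom T,
    forall M, gammoids T' M -> gammoid M &
    forall M, nongammoids T' M -> ~ gammoid M].
  split; first by rewrite /matroid_tableau domE equivE.
  by split=> //; rewrite ?strictE // domE equivE.
have goal_minor : minors (goal T) (goal T) := minor_refl (goal T).
case: cases => [[gE nE [M gM GM]]|[gE nE D23]].
  have [domG _] := eqdom _ _ GM.
  (* The class of the goal contains the gammoid M, so (iv) leaves only the all-gammoid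
     alternative. *)
  have gG : gammoid (goal T).
    have [|nG] := cT _ domG; first by apply; apply: eqrefl.
    by case: (nG _ GM); apply: gT.
  split; last by rewrite nE.
    rewrite /tableau_dom goalE gE strictE nE; congr (_ `|` _ `|` _)%classic.
    rewrite [X in (_ `|` X)%classic]classical_sets.setUC.
    by rewrite classical_sets.setUA classical_sets.setUid.
  by move=> N; rewrite gE => -[/gT//|/gammoid_minor]; apply.
have nG : ~ gammoid (goal T).
  case: D23 => [[X nX [N NG XN]] gG|D gG].
    exact: nT _ nX (gammoid_iso Kinf XN (gammoid_minor NG gG)).
  have [V [J [B [P cV]]]] := small_presentation gG.
  have [N [NG cN sN]] := strict_extension Kinf P cV.
  (* (D3) matches the strict gammoid N with a member of [nonstrict T], which would then be a strict
     gammoid as well. *)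
  have [M nM MN] := D N NG cN.
  exact: sT _ nM (strict_gammoid_iso MN sN).
split; [|by rewrite gE|by move=> N; rewrite nE => -[/nT//|->]].
rewrite /tableau_dom goalE gE strictE nE; apply/seteqP; split=> N /=.
  by case=> [|[|->]]; [left|right|left; left; left].
by case; [left|right; left].
Qed.
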